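(* Let $d\geq 2$, let $T_d$ be the $d$-regular rooted tree, and let $G\leq\operatorname{Aut}(T_d)$ be a finitely generated self-replicating branch group with the weak subgroup induction property. Then $G$ has jump rational cohomology of height $1$ and infinite rational cohomological dimension.
   Context: The rational cohomological dimension $\operatorname{cd}_{\mathbf Q}(H)$ of a group $H$ is the projective dimension of the trivial module $\mathbf Q$ over the group ring $\mathbf Q[H]$. A group $G$ has jump rational cohomology of height $n$ (for an integer $n\geq 0$) if every subgroup $H\leq G$ with $\operatorname{cd}_{\mathbf Q}(H)<\infty$ satisfies $\operatorname{cd}_{\mathbf Q}(H)\leq n$. The vertices of the $d$-regular rooted tree $T=T_d$ are identified with the words in $\{1,\dots,d\}^*$; the root is the empty word, the children of $v$ are $v1,\dots,vd$, and $\mathcal L_n$ is the set of words of length $n$. $\operatorname{Aut}(T)$ is the group of automorphisms of $T$ (fixing the root). For a vertex $v$, $T_v$ is the subtree of all words with prefix $v$. For $g\in\operatorname{Aut}(T)$ and a vertex $v$, the section $\varphi_v(g)\in\operatorname{Aut}(T)$ is the unique automorphism with $g\cdot(vw)=(g\cdot v)(\varphi_v(g)\cdot w)$ for all $w\in T$; $\varphi_v$ is a homomorphism on the stabilizer of $v$. For $G\leq\operatorname{Aut}(T)$ and a set $V$ of vertices, $\operatorname{Stab}_G(V)$ is the pointwise stabilizer of $V$ in $G$. $\operatorname{Rist}_G(v)$ is the subgroup of elements of $G$ acting trivially outside $T_v$, and $\operatorname{Rist}_G(\mathcal L_n)$ is the subgroup generated by all $\operatorname{Rist}_G(v)$, $v\in\mathcal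 L_n$. $G$ is branch if it acts transitively on every $\mathcal L_n$, all $\operatorname{Rist}_G(v)$ are infinite, and every $\operatorname{Rist}_G(\mathcal L_n)$ has finite index in $G$. $G$ is self-replicating if $\varphi_v(\operatorname{Stab}_G(v))=G$ for all vertices $v$. A transversal of $T$ is a set $X$ of vertices such that every infinite ray starting at the root passes through exactly one element of $X$ (such an $X$ is finite). $G$ has the weak subgroup induction property if for every finitely generated subgroup $H\leq G$ there is a transversal $X$ of $T$ such that for each $v\in X$ the group $\varphi_v(\operatorname{Stab}_H(X))$ is either trivial or of finite index in $\varphi_v(\operatorname{Stab}_G(v))$. *)

(* Defs.v *)
From HB Require Import structures.
From mathcomp Require Import all_boot all_order all_algebra.
From mathcomp Require Import finmap.
From mathcomp.multinomials Require Import monalg.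
From mathcomp Require Import boolp classical_sets functions cardinality.

Set Implicit Arguments.
Unset Strict Implicit.
Unset Printing Implicit Defensive.

Import GRing.Theory.

Local Open Scope classical_set_scope.
Local Open Scope ring_scope.

(* The multiplication of [{malg R[K]}] in multinomials requires [K] to be a
   monoid without nontrivial units, so it is not available on a group [G]. *)

Definition group_ring (R : nzRingType) (G : groupType) : Type := {malg R[G]}.

HB.instance Definition _ (R : nzRingType) (G : groupType) :=
  GRing.Zmodule.copy (group_ring R G) {malg R[G]}.

Section GroupRing.
Variables (R : nzRingType) (G : groupType).
Implicit Types a b c : group_ring R G.

Definition gr_one : group_ring R G := << 1 *g (1%g : G) >>.

Definition gr_mul a b : group_ring R G :=
  \sum_(g <- msupp a) \sum_(h <- msupp b) << a@_g * b@_h *g (g * h)%g >>.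

Lemma gr_mulw (d1 d2 : {fset G}) a b :
  (msupp a `<=` d1)%fset -> (msupp b `<=` d2)%fset ->
  gr_mul a b = \sum_(g <- d1) \sum_(h <- d2) << a@_g * b@_h *g (g * h)%g >>.
Proof.
move=> le1 le2; rewrite /gr_mul (big_fset_incl _ le1) /=.
  apply/eq_bigr=> g _; apply/big_fset_incl => // h _ /mcoeff_outdom ->.
  by rewrite mulr0 monalgU0.
move=> g _ /mcoeff_outdom ag.
by rewrite big1 // => h _; rewrite ag mul0r monalgU0.
Qed.

Lemma gr_mul0 : left_zero 0 gr_mul.
Proof. by move=> a; rewrite /gr_mul msupp0 big_seq_fset0. Qed.

Lemma gr_mulr0 : right_zero 0 gr_mul.
Proof.
by move=> a; rewrite /gr_mul big1 // => g _; rewrite msupp0 big_seq_fset0.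
Qed.

Lemma gr_mulUU (x y : R) (g h : G) :
  gr_mul << x *g g >> << y *g h >> = << x * y *g (g * h)%g >>.
Proof. by rewrite (gr_mulw msuppU_le msuppU_le) !big_seq_fset1 !mcoeffUU. Qed.

Lemma gr_mulDl : left_distributive gr_mul +%R.
Proof.
move=> a b c.
rewrite (gr_mulw (msuppD_le a b) (fsubset_refl (msupp c))).
rewrite (gr_mulw (fsubsetUl (msupp a) (msupp b)) (fsubset_refl (msupp c))).
rewrite (gr_mulw (fsubsetUr (msupp a) (msupp b)) (fsubset_refl (msupp c))).
rewrite -big_split /=; apply/eq_bigr=> g _.
rewrite -big_split /=; apply/eq_bigr=> h _.
by rewrite mcoeffD mulrDl monalgUD.
Qed.

Lemma gr_mulDr : right_distributive gr_mul +%R.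
Proof.
move=> a b c.
rewrite (gr_mulw (fsubset_refl (msupp a)) (msuppD_le b c)).
rewrite (gr_mulw (fsubset_refl (msupp a)) (fsubsetUl (msupp b) (msupp c))).
rewrite (gr_mulw (fsubset_refl (msupp a)) (fsubsetUr (msupp b) (msupp c))).
rewrite -big_split /=; apply/eq_bigr=> g _.
rewrite -big_split /=; apply/eq_bigr=> h _.
by rewrite mcoeffD mulrDr monalgUD.
Qed.

Lemma gr_suml I (r : seq I) (F : I -> group_ring R G) a :
  gr_mul (\sum_(i <- r) F i) a = \sum_(i <- r) gr_mul (F i) a.
Proof.
exact: (big_morph (fun x => gr_mul x a) (fun x y => gr_mulDl x y a) (gr_mul0 a)).
Qed.

Lemma gr_sumr I (r : seq I) (F : I -> group_ring R G) a :
  gr_mul a (\sum_(i <- r) F i) = \sum_(i <- r) gr_mul a (F i).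
Proof. exact: (big_morph (gr_mul a) (gr_mulDr a) (gr_mulr0 a)). Qed.

Lemma gr_mulA : associative gr_mul.
Proof.
move=> a b c; rewrite [a]monalgE (gr_suml _ _ (gr_mul b c)) (gr_suml _ _ b).
rewrite (gr_suml _ _ c); apply/eq_bigr=> g _; set u := << _ *g g >>.
rewrite [b]monalgE (gr_suml _ _ c) (gr_sumr _ _ u) [in RHS](gr_sumr _ _ u).
rewrite (gr_suml _ _ c); apply/eq_bigr=> h _; set v := << _ *g h >>.
rewrite [c]monalgE (gr_sumr _ _ v) (gr_sumr _ _ u) (gr_sumr _ _ (gr_mul u v)).
by apply/eq_bigr=> k _; rewrite !gr_mulUU mulrA mulgA.
Qed.

Lemma gr_mul1 : left_id gr_one gr_mul.
Proof.
move=> a; rewrite [a]monalgE gr_sumr.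
by apply/eq_bigr=> g _; rewrite gr_mulUU mul1r mul1g.
Qed.

Lemma gr_mulr1 : right_id gr_one gr_mul.
Proof.
move=> a; rewrite [a]monalgE gr_suml.
by apply/eq_bigr=> g _; rewrite gr_mulUU mulr1 mulg1.
Qed.

Lemma gr_one_neq0 : gr_one != 0.
Proof. by rewrite monalgU_eq0 oner_eq0. Qed.

HB.instance Definition _ := GRing.Zmodule_isNzRing.Build (group_ring R G)
  gr_mulA gr_mul1 gr_mulr1 gr_mulDl gr_mulDr gr_one_neq0.

Definition augmentation a : R := \sum_(g <- msupp a) a@_g.

Lemma augmentationw (d : {fset G}) a :
  (msupp a `<=` d)%fset -> augmentation a = \sum_(g <- d) a@_g.
Proof.
by move=> le; apply/big_fset_incl => // g _ /mcoeff_outdom.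
Qed.

Lemma augmentationU (x : R) (g : G) : augmentation << x *g g >> = x.
Proof. by rewrite (augmentationw msuppU_le) big_seq_fset1 mcoeffUU. Qed.

Lemma augmentationD : {morph augmentation : a b / a + b}.
Proof.
move=> a b; rewrite (augmentationw (msuppD_le a b)).
rewrite (augmentationw (fsubsetUl (msupp a) (msupp b))).
rewrite (augmentationw (fsubsetUr (msupp a) (msupp b))).
by rewrite -big_split /=; apply/eq_bigr=> g _; rewrite mcoeffD.
Qed.

Lemma augmentation1 : augmentation 1 = 1.
Proof. exact: augmentationU. Qed.

Lemma augmentation_sum I (r : seq I) (F : I -> group_ring R G) :
  augmentation (\sum_(i <- r) F i) = \sum_(i <- r) augmentation (F i).
Proof.
apply: (big_morph augmentation augmentationD).
by rewrite /augmentation msupp0 big_seq_fset0.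
Qed.

Lemma augmentationM : {morph augmentation : a b / a * b}.
Proof.
move=> a b; rewrite augmentation_sum mulr_suml; apply/eq_bigr=> g _.
rewrite augmentation_sum mulr_sumr; apply/eq_bigr=> h _.
exact: augmentationU.
Qed.

End GroupRing.

(* [G] only serves to select the module structure. *)
Definition trivial_module (R : nzRingType) (G : groupType) : Type := R.

HB.instance Definition _ (R : nzRingType) (G : groupType) :=
  GRing.Zmodule.copy (trivial_module R G) R.

Section TrivialModule.
Variables (R : nzRingType) (G : groupType).
Implicit Types (a b : group_ring R G) (x y : trivial_module R G).

Definition triv_scale a x : trivial_module R G := augmentation a * (x : R).

Lemma triv_scaleA a b x : triv_scale a (triv_scale b x) = triv_scale (a * b) x.
Proof. by rewrite /triv_scale augmentationM mulrA. Qed.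

Lemma triv_scale1 : left_id 1 triv_scale.
Proof. by move=> x; rewrite /triv_scale augmentation1 mul1r. Qed.

Lemma triv_scaleDr : right_distributive triv_scale +%R.
Proof. by move=> a x y; rewrite /triv_scale mulrDr. Qed.

Lemma triv_scaleDl x : {morph triv_scale^~ x : a b / a + b}.
Proof. by move=> a b; rewrite /triv_scale augmentationD mulrDl. Qed.

HB.instance Definition _ :=
  GRing.Zmodule_isLmodule.Build (group_ring R G) (trivial_module R G)
    triv_scaleA triv_scale1 triv_scaleDr triv_scaleDl.

End TrivialModule.

Section ProjectiveDimension.
Variable R : nzRingType.

Definition projective (P : lmodType R) : Prop :=
  forall (M N : lmodType R) (f : {linear M -> N}) (g : {linear P -> N}),
    (forall y, exists x, f x = y) ->
    exists h : {linear P -> M}, forall x, f (h x) = g x.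

(* There is a resolution 0 -> P_n -> ... -> P_0 -> M -> 0 by projectives,
   written as an infinite one that vanishes in degrees above n. *)
Definition projdim_le (M : lmodType R) (n : nat) : Prop :=
  exists (P : nat -> lmodType R) (d : forall i, {linear P i.+1 -> P i})
    (e : {linear P 0 -> M}),
    [/\ forall i, projective (P i),
        forall y, exists x, e x = y,
        forall x, e x = 0 <-> exists y, d 0 y = x,
        forall i x, d i x = 0 <-> exists y, d i.+1 y = x
      & forall i, (n < i)%N -> forall x : P i, x = 0].

End ProjectiveDimension.

Section Cohomology.
Variables (R : nzRingType) (G : groupType).

Definition cd_le (n : nat) : Prop := projdim_le (trivial_module R G) n.

Definition cd_finite : Prop := exists n, cd_le n.

End Cohomology.

Local Open Scope group_scope.

Definition subgroup_type (A : groupType) (H : groupClosed A) : Type :=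
  {x : A | x \in H}.

Lemma groupClosed_closed (A : groupType) (H : groupClosed A) :
  group_closed (fun x : A => x \in H).
Proof. by split; [exact: gpred1 | exact: gpredF]. Qed.

HB.instance Definition _ (A : groupType) (H : groupClosed A) :=
  SubChoice.on (subgroup_type H).
HB.instance Definition _ (A : groupType) (H : groupClosed A) :=
  SubChoice_isSubGroup.Build A (fun x => x \in H) (subgroup_type H)
    (groupClosed_closed H).

Section Subgroups.
Variable A : groupType.

Definition jump_cohomology (R : nzRingType) (G : groupClosed A) (n : nat) :=
  forall H : groupClosed A, {subset H <= G} ->
    cd_finite R (subgroup_type H) -> cd_le R (subgroup_type H) n.

Definition generated (S : set A) : set A :=
  [set x | forall H : groupClosed A, S `<=` [set` H] -> x \in H].

Definition finitely_generated (G : groupClosed A) : Prop :=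
  exists s : seq A, [set` G] = generated [set` s].

(* [K] is meant to be a subgroup of the group [G]. *)
Definition finite_index (K G : set A) : Prop :=
  finite_set [set [set g * k | k in K] | g in G].

End Subgroups.

Definition tree_adj (d : nat) (u v : seq 'I_d) : bool :=
  [exists i, (v == rcons u i) || (u == rcons v i)].

Record tree_aut (d : nat) := TreeAut {
  aut_fun :> seq 'I_d -> seq 'I_d;
  aut_inv : seq 'I_d -> seq 'I_d;
  aut_funK : cancel aut_fun aut_inv;
  aut_invK : cancel aut_inv aut_fun;
  aut_root : aut_fun [::] = [::];
  aut_adj : {mono aut_fun : u v / tree_adj u v}
}.

HB.instance Definition _ (d : nat) := gen_eqMixin (tree_aut d).
HB.instance Definition _ (d : nat) := gen_choiceMixin (tree_aut d).

Section TreeAut.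
Variable d : nat.
Implicit Types (f g h : tree_aut d) (u v w : seq 'I_d).

Lemma tree_autP f g : f =1 g -> f = g.
Proof.
case: f g => [f f' fK f'K f0 fa] [g g' gK g'K g0 ga] /= efg.
have {}efg : f = g by apply/funext.
subst g; have e' : f' = g'.
  by apply/funext => v; rewrite -{1}(g'K v) fK.
subst g'; congr TreeAut; exact: Prop_irrelevance.
Qed.

Definition aut1 : tree_aut d :=
  @TreeAut d id id (fun=> erefl) (fun=> erefl) erefl (fun _ _ => erefl).

Lemma aut_inv_root f : aut_inv f [::] = [::].
Proof. by rewrite -{1}(aut_root f) aut_funK. Qed.

Lemma aut_inv_adj f : {mono aut_inv f : u v / tree_adj u v}.
Proof. by move=> u v; rewrite -(aut_adj f) !aut_invK. Qed.

Definition autV f : tree_aut d :=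
  TreeAut (aut_invK f) (aut_funK f) (aut_inv_root f) (aut_inv_adj f).

Lemma autM_root f g : (f \o g) [::] = [::].
Proof. by rewrite /= !aut_root. Qed.

Lemma autM_adj f g : {mono f \o g : u v / tree_adj u v}.
Proof. by move=> u v; rewrite /= !aut_adj. Qed.

Definition autM f g : tree_aut d :=
  TreeAut (can_comp (aut_funK f) (aut_funK g))
    (can_comp (aut_invK g) (aut_invK f)) (autM_root f g) (autM_adj f g).

Lemma autMA : associative autM.
Proof. by move=> f g h; apply: tree_autP. Qed.

Lemma aut1M : left_id aut1 autM.
Proof. by move=> f; apply: tree_autP. Qed.

Lemma autM1 : right_id aut1 autM.
Proof. by move=> f; apply: tree_autP. Qed.

Lemma autVM : left_inverse aut1 autV autM.
Proof. by move=> f; apply: tree_autP => v /=; rewrite aut_funK. Qed.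

Lemma autMV : right_inverse aut1 autV autM.
Proof. by move=> f; apply: tree_autP => v /=; rewrite aut_invK. Qed.

HB.instance Definition _ :=
  isGroup.Build (tree_aut d) autMA aut1M autM1 autVM autMV.

Lemma tree_adj_rcons u i : tree_adj u (rcons u i).
Proof. by apply/existsP; exists i; rewrite eqxx. Qed.

Lemma aut_rcons f u i : exists j, f (rcons u i) = rcons (f u) j.
Proof.
elim/last_ind: u i => [|u k IH] i.
  have := tree_adj_rcons [::] i; rewrite -(aut_adj f) => /existsP[j].
  case/orP => /eqP; first by exists j.
  by rewrite aut_root; case: (f _).
have [k' ek] := IH k.
have := tree_adj_rcons (rcons u k) i; rewrite -(aut_adj f) => /existsP[j].
case/orP => /eqP; first by exists j.
rewrite ek => /rcons_inj[fu _].
have /(congr1 size) := can_inj (aut_funK f) fu.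
by rewrite !size_rcons => /eqP; rewrite -addn2 -[X in X == _]addn0 eqn_add2l.
Qed.

Lemma aut_cat f u w : exists w', f (u ++ w) = f u ++ w' /\ size w' = size w.
Proof.
elim/last_ind: w => [|w i [w' [ew sw]]]; first by exists [::]; rewrite !cats0.
have [j ej] := aut_rcons f (u ++ w) i; exists (rcons w' j).
by rewrite -rcons_cat ej ew rcons_cat !size_rcons sw.
Qed.

Lemma size_aut f u : size (f u) = size u.
Proof.
by have [w' []] := aut_cat f [::] u; rewrite aut_root /= => ->.
Qed.

Definition section_fun f v w : seq 'I_d := drop (size v) (f (v ++ w)).

Lemma section_funE f v w : f (v ++ w) = f v ++ section_fun f v w.
Proof.
have [w' [ew _]] := aut_cat f v w.
by rewrite /section_fun ew drop_size_cat // size_aut.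
Qed.

Lemma section_funK f v :
  cancel (section_fun f v) (section_fun (autV f) (f v)).
Proof.
move=> w; have := section_funE (autV f) (f v) (section_fun f v w).
rewrite -section_funE /= !aut_funK => /eqP.
by rewrite eqseq_cat // eqxx => /eqP <-.
Qed.

Lemma section_invK f v :
  cancel (section_fun (autV f) (f v)) (section_fun f v).
Proof.
move=> w; set s := section_fun (autV f) (f v) w.
have /= := section_funE (autV f) (f v) w; rewrite -/s aut_funK => es.
have := section_funE f v s; rewrite -es aut_invK => /eqP.
by rewrite eqseq_cat // eqxx => /eqP <-.
Qed.

Lemma section_root f v : section_fun f v [::] = [::].
Proof. by rewrite /section_fun cats0 drop_oversize // size_aut. Qed.

Lemma tree_adj_cat u v w : tree_adj (u ++ v) (u ++ w) = tree_adj v w.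
Proof.
apply: eq_existsb => i.
by rewrite !rcons_cat !eqseq_cat // !eqxx.
Qed.

Lemma section_adj f v : {mono section_fun f v : u w / tree_adj u w}.
Proof.
by move=> u w; rewrite -(tree_adj_cat (f v)) -!section_funE aut_adj tree_adj_cat.
Qed.

Definition section f v : tree_aut d :=
  TreeAut (section_funK f v) (section_invK f v) (section_root f v)
    (section_adj f v).

Lemma sectionE f v w : f (v ++ w) = f v ++ section f v w.
Proof. exact: section_funE. Qed.

End TreeAut.

Section Branch.
Variables (d : nat) (G : groupClosed (tree_aut d)).
Implicit Types (u v : seq 'I_d) (V : set (seq 'I_d)).

Definition Stab V : set (tree_aut d) :=
  [set g | g \in G /\ forall v, V v -> g v = v].

Definition Rist v : set (tree_aut d) :=
  [set g | g \in G /\ forall w, ~~ prefix v w -> g w = w].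

Definition Rist_level (n : nat) : set (tree_aut d) :=
  generated (\bigcup_(v in [set v | size v = n]) Rist v).

Definition level_transitive : Prop :=
  forall u v, size u = size v -> exists2 g, g \in G & g u = v.

Definition branch : Prop :=
  [/\ level_transitive,
      forall v, infinite_set (Rist v)
    & forall n, finite_index (Rist_level n) [set` G]].

Definition self_replicating : Prop :=
  forall v, [set section g v | g in Stab [set v]] = [set` G].

End Branch.

(* A ray from the root is a sequence [r] of letters; its vertices are the finite
   prefixes of [r]. *)
Definition tree_transversal (d : nat) (X : set (seq 'I_d)) : Prop :=
  forall r : nat -> 'I_d, exists! v, X v /\ exists n, v = mkseq r n.

Definition weak_subgroup_induction (d : nat) (G : groupClosed (tree_aut d)) :=
  forall H : groupClosed (tree_aut d), {subset H <= G} ->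
    finitely_generated H ->
    exists2 X : set (seq 'I_d), tree_transversal X &
      forall v, X v ->
        [set section g v | g in Stab H X] = [set 1] \/
        finite_index [set section g v | g in Stab H X]
                     [set section g v | g in Stab G [set v]].

(* Main.v *)
From HB Require Import structures.
Require Import Defs.
From mathcomp Require Import all_boot all_order all_algebra.
From mathcomp Require Import finmap.
From mathcomp.multinomials Require Import monalg.
From mathcomp Require Import boolp classical_sets functions cardinality.

Set Implicit Arguments.
Unset Strict Implicit.
Unset Printing Implicit Defensive.

Import GRing.Theory.

(** Both halves follow from one fact: every infinite
    finitely generated subgroup of [G] contains, for each [n], an internal
    direct product of [n] infinite finitely generated groups
    ([infinite_fg_chain]), and a group containing such a product has rational
    cohomological dimension at least [n] ([infinite_chain_cd]).  Applied to [G]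
    this gives infinite dimension.  Applied to the subgroups of an [H <= G] of
    finite dimension it shows that [H] is locally finite; as [G] is finitely
    generated, [H] is also countable, and a countable locally finite group has
    rational dimension at most one ([locally_finite_cd]).

    Products inside [H].  Let [H <= G] be infinite and finitely generated, [X] a
    transversal given by weak subgroup induction and [K = Stab_H(X)].  Since [X]
    is finite, [K] is nontrivial, and an element of [K] whose sections at [X] are
    all trivial is trivial.  Dropping the vertices of [X] one at a time, there is
    a [v] in [X] and a normal subgroup [L <> 1] of [K] on which the section at
    [v] is injective.  The image [Q] of [K] under that section is not trivial, so
    it has finite index in [G].  The section [m] at [v] of an [l <> 1] in [L] moves
    some vertex [w].  Below [w] there are arbitrarily many incomparable vertices
    [u]; for each, [Q] and the rigid stabilizer of [u] have in common an infinite
    finitely generated group [<E>], because the rigid stabilizer of the level has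
    finite index in [G] and finite generation passes to subgroups of finite index
    in the weak form [infinite_fg_finite_index].  For [k] in [K] with section [a] in
    [E], the commutator of [k] and [l] lies in [L], and its section
    [a * (m * a^-1 * m^-1)] lives on the trees below [u] and [m u]; on the tree
    below [u] it is [a].  These commutators therefore generate an infinite group,
    and the groups obtained from different [u] have disjoint supports.

    Dimension of products.  This is a depth argument in place of the Kuenneth
    formula, whose form for cohomology asks more of the factors than finite
    generation.  For a group generated by a finite set [X], let [T_X(N)] be the
    cokernel of [N -> N^X, n |-> (s n - n)_s].  On exact sequences of modules
    without [X]-invariants [T_X] is exact.  Projective modules have no invariants under an infinite subgroup, and this persists for [T_X(P)] and a
    second infinite subgroup commuting with and independent of the first.  If the
    trivial module had a projective resolution of length less than the number
    [n] of factors, applying the functors [T_X] one after the other would shorten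
    it until nothing is left, and the trivial module would have no nonzero
    invariants ([resolution_invariant]). *)

Local Open Scope classical_set_scope.
Local Open Scope ring_scope.

(** * Generated subgroups *)

Section Generation.
Local Open Scope group_scope.
Variable A : groupType.
Implicit Types (S P : set A) (x y : A).

Definition subgroup P := P 1 /\ forall x y, P x -> P y -> P (x / y).

Lemma subgroupV P x : subgroup P -> P x -> P x^-1.
Proof. by case=> P1 PF Px; rewrite -(mul1g x^-1); exact: PF. Qed.

Lemma subgroupM P x y : subgroup P -> P x -> P y -> P (x * y).
Proof.
by move=> sP Px Py; rewrite -[y]invgK; apply: sP.2 => //; apply: subgroupV.
Qed.

Lemma subgroup_groupClosed P : subgroup P -> exists H : groupClosed A, [set` H] = P.
Proof.
move=> sP; pose p : {pred A} := fun x => `[< P x >].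
have pP x : x \in p <-> P x by split=> [h|Px]; [exact: (asboolW h) | exact: (asboolT Px)].
have pM : mulg_closed p by move=> x y /pP Px /pP Py; apply/pP; exact: (subgroupM sP Px Py).
have p1 : 1 \in p by apply/pP; case: sP.
have pV : invg_closed p by move=> x /pP Px; apply/pP; exact: (subgroupV sP Px).
pose mM := isMulClosed.Build A p pM; pose m1 := isMul1Closed.Build A p p1.
pose mV := isInvClosed.Build A p pV.
pose H : groupClosed A := HB.pack p mM m1 mV.
by exists H; apply/seteqP; split=> x /pP.
Qed.

Lemma generated_subgroup S : subgroup (generated S).
Proof.
split=> [H _|x y Gx Gy H SH]; first exact: gpred1.
by apply: gpredF; [apply: Gx | apply: Gy].
Qed.

Lemma generated_sub S : S `<=` generated S.
Proof. by move=> x Sx H SH; apply: SH. Qed.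

Lemma generated_min S P : subgroup P -> S `<=` P -> generated S `<=` P.
Proof.
by move=> /subgroup_groupClosed[H HP] SP x /(_ H); rewrite -HP in SP *; apply.
Qed.

Lemma generatedS S P : S `<=` P -> generated S `<=` generated P.
Proof.
move=> SP; apply: generated_min; first exact: generated_subgroup.
by move=> x /SP; apply: generated_sub.
Qed.

Definition centralizer S : set A := [set x | forall y, S y -> x * y = y * x].

(** For [B = 1] this is an internal direct product of infinite groups, generated
    by the entries of [Xs].  The subgroup [B'] accumulating the factors is left
    free above [B] and [X]: in a tree it is convenient to take everything
    supported on given subtrees. *)
Fixpoint infinite_chain (B : set A) (Xs : seq (seq A)) : Prop :=
  if Xs is X :: Xs' then
    [/\ infinite_set (generated [set` X]),
        forall a, generated [set` X] a -> B a -> a = 1,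
        generated [set` X] `<=` centralizer B &
        exists B', [/\ subgroup B', B `<=` B', [set` X] `<=` B' &
                       infinite_chain B' Xs']]
  else True.

(** Commutation with the accumulated subgroup passes down the chain because that
    subgroup only grows. *)
Lemma infinite_chain_centralizer B Xs : infinite_chain B Xs ->
  forall X, X \in Xs -> [set` X] `<=` centralizer B.
Proof.
elim: Xs B => [//|X Xs IH] B [_ _ cX [B' [_ BB' _ /IH cXs]]] X'.
rewrite inE => /orP[/eqP -> s Xs'|/cXs cX' s /cX' cs y /BB' By]; last exact: cs.
exact/cX/generated_sub.
Qed.

End Generation.

(** * Operator modules *)

Section Operators.
Variable A : groupType.

(** A quotient of a representation, kept as a representation together with the
    subgroup [null] that is to be divided out: [coker] and [pull] below then
    change carriers and null subgroups without forming quotient types.  Stability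
    of the null subgroup is a separate condition, [stable]: in a cokernel it holds
    only for the operators commuting with the generators used to form it. *)
Record opmod := Opmod {
  opcar :> zmodType;
  null : set opcar;
  op : A -> opcar -> opcar;
  null0 : null 0;
  nullB : forall x y, null x -> null y -> null (x - y);
  opB : forall g x y, op g (x - y) = op g x - op g y;
  op1 : forall x, op 1%g x = x;
  opM : forall g h x, op (g * h)%g x = op g (op h x) }.

Section Basics.
Variable P : opmod.
Implicit Types x y z : P.

Lemma nullN x : null x -> null (- x).
Proof. by move=> nx; rewrite -sub0r; apply: nullB => //; apply: null0. Qed.

Lemma nullD x y : null x -> null y -> null (x + y).
Proof. by move=> nx ny; rewrite -[y]opprK; apply: nullB => //; apply: nullN. Qed.

Lemma op0 g : op g (0 : P) = 0.
Proof. by rewrite -{1}(subrr 0) opB subrr. Qed.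

(** Equality in the quotient by the null subgroup. *)
Definition eqop x y := null (x - y).

Lemma eqop_refl x : eqop x x. Proof. by rewrite /eqop subrr; apply: null0. Qed.

Lemma eqop_sym x y : eqop x y -> eqop y x.
Proof. by move/nullN; rewrite /eqop opprB. Qed.

Lemma eqop_trans y x z : eqop x y -> eqop y z -> eqop x z.
Proof. by move=> /nullD h /h; rewrite /eqop addrA subrK. Qed.

Lemma eqop_null x y : eqop x y -> null y -> null x.
Proof. by move=> exy ny; rewrite -[x](subrK y); apply: nullD. Qed.

Lemma eqopB x y x' y' : eqop x x' -> eqop y y' -> eqop (x - y) (x' - y').
Proof.
move=> ex ey; have := nullB ex ey.
by rewrite /eqop !opprD !opprK addrACA.
Qed.

Definition stable (C : set A) := forall g x, C g -> null x -> null (op g x).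

Definition invariant (X : seq A) x := forall s, s \in X -> eqop (op s x) x.

Lemma invariant_generated X x : stable (generated [set` X]) -> invariant X x ->
  forall a, generated [set` X] a -> eqop (op a x) x.
Proof.
move=> st inv a Ga; have [] // : generated [set` X] a /\ eqop (op a x) x.
move: a Ga; apply: generated_min.
  split=> [|a b [Ga ea] [Gb eb]].
    by split; [apply: (generated_subgroup _).1 | rewrite op1; apply: eqop_refl].
  have Gab : generated [set` X] (a / b)%g by apply: (generated_subgroup _).2.
  split=> //; apply: eqop_trans ea; apply: eqop_sym.
  rewrite /eqop -[a in op a x](mulgVK b a) opM -opB; apply: st => //.
move=> s Xs; split; [exact: generated_sub | exact: inv].
Qed.

End Basics.

Section Coker.
Variables (P : opmod) (X : seq A).

(** The functor [T_X]: the cokernel of [n |-> (s n - n)_(s \in X)], which is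
    [M (x) P] for the module [M] presented by the column of the [s - 1].  Tuples
    indexed by [X] are represented by functions on the whole group, whose values
    off [X] are then null. *)
Definition coker_null : set (A -> P) :=
  [set f | exists n, forall s, s \in X -> eqop (f s) (op s n - n)].

Lemma coker_null0 : coker_null 0.
Proof. by exists 0 => s _; rewrite op0 subrr; apply: eqop_refl. Qed.

Lemma coker_nullB f g : coker_null f -> coker_null g -> coker_null (f - g).
Proof.
move=> [m fm] [n gn]; exists (m - n) => s Xs.
have := eqopB (fm s Xs) (gn s Xs).
by rewrite opB !opprD !opprK addrACA.
Qed.

Definition coker_op (g : A) (f : A -> P) : A -> P := fun s => op g (f s).

Lemma coker_opB g f h : coker_op g (f - h) = coker_op g f - coker_op g h.
Proof. by apply/funext => s; apply: opB. Qed.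

Lemma coker_op1 f : coker_op 1%g f = f.
Proof. by apply/funext => s; apply: op1. Qed.

Lemma coker_opM g h f : coker_op (g * h)%g f = coker_op g (coker_op h f).
Proof. by apply/funext => s; apply: opM. Qed.

Definition coker : opmod :=
  Opmod coker_null0 coker_nullB coker_opB coker_op1 coker_opM.

End Coker.

Definition translate (g : A) (U : set A) : set A := [set u | U (g^-1 * u)%g].

(** What survives in [T_X(P)] of the decomposition of a free module along the
    group elements: an element has a part supported in [U], computed from
    finitely many positions, for every set [U], and this descends to the quotient
    by the null subgroup as long as [U] is stable under [B].  Direct summands of
    free modules have such parts too, by mapping into the free module and back,
    although taking parts is no longer idempotent there. *)
Record graded (B : set A) (P : opmod) : Prop := Graded {
  graded_stable : stable P (centralizer B);
  graded_res : exists res : set A -> P -> P,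
    [/\ forall U x y, res U (x - y) = res U x - res U y,
        forall g U x, res (translate g U) (op g x) = op g (res U x),
        forall U x, (forall b u, B b -> U u -> U (b * u)%g) ->
          null x -> null (res U x) &
        forall x, exists D : seq A, forall U,
          ((forall d, d \in D -> U d) -> eqop (res U x) x) /\
          ((forall d, d \in D -> ~ U d) -> null (res U x))] }.

(** An operator commuting with [X] maps [s n - n] to [s (g n) - g n]. *)
Lemma coker_stable (P : opmod) (X : seq A) (C : set A) :
  stable P C -> C `<=` centralizer [set` X] ->
  stable (coker P X) C.
Proof.
move=> st CX g f Cg [n fn]; exists (op g n) => s Xs.
have := st g _ Cg (fn s Xs).
by rewrite !opB -!opM (CX g Cg s Xs).
Qed.

(** A set [U] stable under the generators [X] is fixed by translation by them, so
    taking parts supported in [U] commutes with each [s - 1] and hence preserves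
    their image. *)
Lemma graded_coker (B B' : set A) (P : opmod) (X : seq A) :
    subgroup B' -> B `<=` B' -> [set` X] `<=` B' ->
  graded B P -> graded B' (coker P X).
Proof.
move=> sB' BB' XB' [st [res [resB resT resN resD]]]; split.
  have CB : centralizer B' `<=` centralizer B by move=> g cg y /BB' /cg.
  apply: coker_stable; first by move=> g x /CB; apply: st.
  by move=> g cg s /XB' /cg.
exists (fun U f => res U \o f); split.
- by move=> U f g; apply/funext => s; apply: resB.
- by move=> g U f; apply/funext => s; apply: resT.
- move=> U f UB [n fn]; exists (res U n) => s Xs /=.
  have Us : translate s U = U.
    apply/seteqP; split=> u /= Uu; last first.
      by apply: UB => //; apply: subgroupV => //; apply: XB'.
    by rewrite -[u](mulVKg s); apply: UB => //; apply: XB'.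
  rewrite -resT Us -resB /eqop -resB; apply: resN; last exact: fn.
  by move=> b u /BB'; apply: UB.
- move=> f; pose D s := sval (cid (resD (f s))).
  have DP s := svalP (cid (resD (f s))).
  exists (flatten [seq D s | s <- X]) => U; split=> UD; exists 0 => s Xs.
    rewrite op0 subrr; rewrite /eqop subr0; apply: (DP s U).1 => d Dd.
    by apply: UD; apply/flatten_mapP; exists s.
  rewrite op0 subrr; rewrite /eqop subr0; apply: (DP s U).2 => d Dd.
  by apply: UD; apply/flatten_mapP; exists s.
Qed.

(** For given [d] and [d'] in [D] at most one [a] in [H] is excluded, since [H]
    meets [B] trivially; so finitely many [a] are excluded in all. *)
Lemma infinite_avoid (B : set A) (H : set A) (D : seq A) :
    subgroup B -> subgroup H -> infinite_set H -> (forall a, H a -> B a -> a = 1%g) ->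
  exists2 a, H a & forall b d d', B b -> d \in D -> d' \in D -> d <> (a * (b * d'))%g.
Proof.
move=> sB sH infH HB; apply: contrapT => none; apply: infH.
pose F (dd : A * A) := [set a | H a /\ exists2 b, B b & dd.1 = (a * (b * dd.2))%g].
have H1 dd a a' : F dd a -> F dd a' -> a = a'.
  move=> [Ha [b Bb e1]] [Ha' [b' Bb' e2]].
  apply/(mulgI a'^-1)%g; rewrite mulVg; apply: HB.
    by apply: subgroupM => //; apply: subgroupV.
  have -> : (a'^-1 * a = b' / b)%g; last exact: sB.2.
  apply: (mulIg b); rewrite mulgVK; apply: (mulIg dd.2).
  by rewrite -!mulgA -e1 e2 mulKg.
have : finite_set (\bigcup_(dd in [set` allpairs pair D D]) F dd).
  apply: bigcup_finite => [|dd _]; first exact: finite_seq.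
  have [[a Fa]|nF] := pselect (exists a, F dd a).
    by apply: (sub_finite_set (B := [set a])) => // a' Fa'; apply: H1 Fa' Fa.
  by apply: (sub_finite_set (B := set0)) => // a Fa; case: nF; exists a.
apply: sub_finite_set => a Ha; apply: contrapT => nF; apply: none.
exists a => // b d d' Bb Dd Dd' e; apply: nF; exists (d, d').
  by apply/allpairsP; exists (d, d').
by split=> //; exists b.
Qed.

(** An invariant [x] is concentrated on [U = B D] with [D] finite.  Some [a] in the
    group moves [U] off [D], so the part of [x] in [a U] is null; by invariance it
    is also the translate of the part in [U], which is all of [x]. *)
Lemma graded_invariant (B : set A) (P : opmod) (X : seq A) (x : P) :
    subgroup B -> infinite_set (generated [set` X]) ->
    (forall a, generated [set` X] a -> B a -> a = 1%g) ->
    generated [set` X] `<=` centralizer B ->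
  graded B P -> invariant X x -> null x.
Proof.
move=> sB infX XB cX [st [res [resB resT resN resD]]] invx.
have {}st : stable P (generated [set` X]).
  by move=> g y /cX; apply: st.
have [D DP] := resD x.
have [a Xa aD] := infinite_avoid D sB (generated_subgroup _) infX XB.
have Xa' := subgroupV (generated_subgroup _) Xa.
pose U := [set u | exists b d, [/\ B b, d \in D & u = (b * d)%g]].
have UB b u : B b -> U u -> U (b * u)%g.
  move=> Bb [b' [d [Bb' Dd ->]]]; exists (b * b')%g, d.
  by rewrite mulgA; split=> //; apply: subgroupM.
have xU : eqop (res U x) x.
  apply: (DP U).1 => d Dd; exists 1%g, d.
  by rewrite mul1g; split=> //; apply: sB.1.
have axU : null (res (translate a U) x).
  apply: (DP _).2 => d Dd [b [d' [Bb Dd' e]]]; apply: (aD b d d') => //.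
  by rewrite -e mulVKg.
have aU b u : B b -> translate a U u -> translate a U (b * u)%g.
  move=> Bb /= Uu; rewrite /translate /= mulgA.
  have -> : (a^-1 * b = b * a^-1)%g.
    exact: cX Xa' _ Bb.
  by rewrite -mulgA; apply: UB.
have := resN _ _ aU (invariant_generated st invx Xa).
rewrite resB resT => /eqop_null /(_ axU) /(st a^-1%g).
rewrite -opM mulVg op1 => nU.
exact: (eqop_null (eqop_sym xU)) (nU Xa').
Qed.

Record ophom (P Q : opmod) := Ophom {
  hom :> P -> Q;
  homB : forall x y, hom (x - y) = hom x - hom y;
  hom_op : forall g x, hom (op g x) = op g (hom x) }.

Lemma hom0 (P Q : opmod) (f : ophom P Q) : f 0 = 0.
Proof. by rewrite -(subrr 0) homB subrr. Qed.

Section Pull.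
Variables (P Q : opmod) (f : ophom P Q).

Let pull_null : set P := [set x | null (f x)].

Lemma pull_null0 : pull_null 0.
Proof. by rewrite /pull_null /= hom0; apply: null0. Qed.

Lemma pull_nullB x y : pull_null x -> pull_null y -> pull_null (x - y).
Proof. by rewrite /pull_null /= homB; apply: nullB. Qed.

(** The image of [f], presented as a quotient of its source. *)
Definition pull : opmod :=
  Opmod pull_null0 pull_nullB (@opB P) (@op1 P) (@opM P).

Definition pull_hom : ophom P pull :=
  @Ophom P pull id (fun _ _ => erefl) (fun _ _ => erefl).

End Pull.

Section CokerHom.
Variables (P Q : opmod) (X : seq A) (f : ophom P Q).

Let comp (h : coker P X) : coker Q X := f \o h.

Lemma coker_homB h k : comp (h - k) = comp h - comp k.
Proof. by apply/funext => s; apply: homB. Qed.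

Lemma coker_hom_op g h : comp (op g h) = op g (comp h).
Proof. by apply/funext => s; apply: hom_op. Qed.

Definition coker_hom : ophom (coker P X) (coker Q X) :=
  Ophom coker_homB coker_hom_op.

End CokerHom.

Record resolution (P : nat -> opmod) (N : opmod)
    (d : forall i, ophom (P i.+1) (P i)) (e : ophom (P 0) N) : Prop := Resolution {
  res_onto : forall y, exists x, eqop (e x) y;
  res_exact0 : forall x, null (e x) <-> exists y, eqop x (d 0 y);
  res_exactS : forall i x, null (d i x) <-> exists y, eqop x (d i.+1 y) }.

(** The depth argument, by induction on the number of factors.  Let [Z] be the
    kernel of [P 0 -> N].  Since the terms [P i] have no [X]-invariants, [T_X]
    applied to [P 1, P 2, ...] resolves [T_X(Z)], with one term less and for one
    factor less, so [T_X(Z)] has no invariants under the remaining factors.  But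
    the connecting map of the snake lemma embeds the [X]-invariants of [N] into
    [T_X(Z)], equivariantly for these factors. *)
Theorem resolution_invariant (Xs : seq (seq A)) (B : set A) (P : nat -> opmod)
    (N : opmod) (d : forall i, ophom (P i.+1) (P i)) (e : ophom (P 0) N) :
    subgroup B -> infinite_chain B Xs ->
    resolution d e -> (forall i, graded B (P i)) -> stable N (centralizer B) ->
    (forall i, (size Xs <= i)%N -> forall x : P i, null x) ->
  forall x : N, (forall X, X \in Xs -> invariant X x) -> null x.
Proof.
elim: Xs B P N d e => [|X Xs IH] B P N d e sB.
  move=> _ [onto ex0 exS] _ _ P0 x _; have [y ey] := onto x.
  apply: (eqop_null (eqop_sym ey)); apply/ex0; exists 0.
  by rewrite hom0 /eqop subr0; apply: P0.
move=> [infX XB cX [B' [sB' BB' XB' chainXs]]] [onto ex0 exS] grP stN Pnull x invx.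
have d_eqn i y z : eqop y z -> eqop (d i y) (d i z).
  rewrite /eqop -homB => yz; apply/exS; exists 0.
  by rewrite hom0 /eqop subr0.
have dd i y : null (d i (d i.+1 y)) by apply/exS; exists y; apply: eqop_refl.
have inv0 i (y : P i) : invariant X y -> null y.
  exact: graded_invariant (grP i).
have cX' s : s \in X -> centralizer B s.
  by move=> Xs'; apply/cX/generated_sub.
have op_eqn i s (y z : P i) : centralizer B s -> eqop y z -> eqop (op s y) (op s z).
  by move=> cs; rewrite /eqop -opB; apply: graded_stable (grP i) _ _ cs.
(* [pull (d 0)] is the kernel of [e] *)
pose N' := coker (pull (d 0)) X.
pose P' i := coker (P i.+1) X.
pose d' i : ophom (P' i.+1) (P' i) := coker_hom X (d i.+1).
pose e' : ophom (P' 0) N' := coker_hom X (pull_hom (d 0)).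
(* exactness at [P i.+1], for families of elements indexed by [X] *)
have exX i (x' : P' i) (n : P i.+1) :
    (forall s, s \in X -> null (d i (x' s - (op s n - n)))) <->
    exists y, forall s, s \in X -> eqop (x' s - d i.+1 (y s)) (op s n - n).
  split=> [nx|[y ey] s Xs'].
    have /choice[y ey] s : exists y, s \in X -> eqop (x' s - d i.+1 y) (op s n - n).
      case: (boolP (s \in X)) => [Xs'|_]; last by exists 0.
      by have /exS[y ey] := nx s Xs'; exists y; move: ey; rewrite /eqop addrAC.
    by exists y.
  by apply/exS; exists (y s); move: (ey s Xs'); rewrite /eqop addrAC.
have res' : resolution d' e'.
  split=> [y|x'|i x'].
  - by exists y; apply: eqop_refl.
  - split=> [[n nx]|[y [n ey]]].
      by have [y ey] := (exX 0 x' n).1 nx; exists y, n.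
    by exists n; apply: (exX 0 x' n).2; exists y.
  - split=> [[n nx]|[y [n ey]]]; last first.
      have {}nx := (exX i.+1 x' n).2 (ex_intro _ y ey).
      by exists (d i.+1 n) => s /nx; rewrite !homB hom_op.
    have : null (d i n).
      apply: inv0 => s Xs'; rewrite -hom_op /eqop -homB.
      exact: (eqop_null (d_eqn i _ _ (eqop_sym (nx s Xs'))) (dd i _)).
    move=> /exS[m em]; have [|y ey] := (exX i.+1 x' m).1; last by exists y, m.
    move=> s Xs'; rewrite !homB hom_op.
    apply: (eqop_trans (nx s Xs')); apply: eqopB => //.
    exact: op_eqn (cX' _ Xs') em.
have cB' : centralizer B' `<=` centralizer B by move=> g cg y /BB' /cg.
have stN' : stable N' (centralizer B').
  apply: coker_stable => [g y /cB' cg|g cg s /XB' /cg //].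
  by rewrite /pull /= hom_op; apply: graded_stable (grP 0) _ _ cg.
have null' : forall i, (size Xs <= i)%N -> forall f : P' i, null f.
  by move=> i le_i f; exists 0 => s _; apply: Pnull.
have {}IH := IH B' P' N' d' e' sB' chainXs res'
  (fun i => graded_coker sB' BB' XB' (grP i.+1)) stN' null'.
(* the connecting map sends [x] to the class of [z], where [s y - y = d z s] *)
have [y ey] := onto x.
have e_inv s : centralizer B s -> eqop (op s x) x -> exists z, eqop (op s y - y) (d 0 z).
  move=> cs sx; apply/ex0; rewrite homB hom_op.
  apply: eqop_trans _ (eqop_sym ey); apply: eqop_trans sx.
  by rewrite /eqop -opB; apply: stN.
have /choice[z ez] s : exists z, s \in X -> eqop (op s y - y) (d 0 z).
  case: (boolP (s \in X)) => [Xs'|_]; last by exists 0.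
  have [z ez] := e_inv s (cX' s Xs') (invx X (mem_head _ _) s Xs').
  by exists z.
have [n nz] : null (z : N').
  apply: IH => Y XsY t Yt.
  have ct : centralizer B' t by apply: (infinite_chain_centralizer chainXs XsY).
  have [|u eu] := e_inv t (cB' _ ct).
    by apply: (invx Y) => //; rewrite inE XsY orbT.
  exists u => s Xs' /=.
  have st : (t * s = s * t)%g by apply: ct; apply: XB'.
  suff : eqop (d 0 (op t (z s) - z s)) (d 0 (op s u - u)) by rewrite /eqop -homB.
  have step1 : eqop (op t (d 0 (z s)) - d 0 (z s)) (op t (op s y - y) - (op s y - y)).
    apply: eqopB; last exact/eqop_sym/ez.
    by apply: op_eqn; [exact: cB' | exact/eqop_sym/ez].
  have step2 : eqop (op s (op t y - y) - (op t y - y)) (op s (d 0 u) - d 0 u).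
    by apply: eqopB => //; apply: op_eqn => //; apply: cX'.
  rewrite !homB !hom_op; apply: eqop_trans step1 _; apply: eqop_trans step2.
  by rewrite !opB -!opM st !opprD !opprK addrACA; apply: eqop_refl.
have yn : null (y - d 0 n).
  apply: inv0 => s Xs'; have zn : eqop (d 0 (z s)) (op s (d 0 n) - d 0 n).
    by have := nz s Xs'; rewrite /eqop /= !homB hom_op.
  have := eqop_trans (ez s Xs') zn.
  by rewrite /eqop opB !opprD !opprK addrACA.
by apply: (eqop_null (eqop_sym ey)); apply/ex0; exists n.
Qed.

End Operators.

(** * Projective modules over a group ring *)

Section GroupElements.
Variables (R : nzRingType) (A : groupType).
Local Notation L := (group_ring R A).
Implicit Types (a b : L) (g h : A).

Definition scaled (x : R) (g : A) : L := << x *g g >>.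

Lemma scaledM x y g h : scaled x g * scaled y h = scaled (x * y) (g * h)%g.
Proof. exact: gr_mulUU. Qed.

Lemma scaledD x y g : scaled (x + y) g = scaled x g + scaled y g.
Proof. exact: monalgUD. Qed.

Lemma group_ringE a : a = \sum_(g <- msupp (a : {malg R[A]})) scaled (a : {malg R[A]})@_g g.
Proof. exact: monalgE. Qed.

Lemma mcoeff_scaledM g a h :
  (scaled 1 g * a : {malg R[A]})@_h = (a : {malg R[A]})@_(g^-1 * h)%g.
Proof.
rewrite [in LHS](group_ringE a) mulr_sumr.
rewrite [in RHS](group_ringE a) [LHS]raddf_sum [RHS]raddf_sum /=.
apply: eq_bigr => k _; rewrite scaledM mul1r !mcoeffU.
by congr (_ *+ _); congr nat_of_bool; apply/eqP/eqP => [<-|->]; rewrite ?mulKg ?mulVKg.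
Qed.

Lemma augmentation_scaled x g : augmentation (scaled x g) = x.
Proof. exact: augmentationU. Qed.

Section LmodOps.
Variable M : lmodType L.

Lemma lmod_opB g (x y : M) : scaled 1 g *: (x - y) = scaled 1 g *: x - scaled 1 g *: y.
Proof. exact: scalerBr. Qed.

Lemma lmod_op1 (x : M) : scaled 1 1%g *: x = x.
Proof. exact: scale1r. Qed.

Lemma lmod_opM g h (x : M) : scaled 1 (g * h)%g *: x = scaled 1 g *: (scaled 1 h *: x).
Proof. by rewrite scalerA scaledM mul1r. Qed.

Lemma lmod_nullB (x y : M) : [set 0] x -> [set 0] y -> [set 0] (x - y).
Proof. by move=> -> ->; apply: subrr. Qed.

Definition lmod_op : opmod A :=
  Opmod (erefl 0 : [set 0] 0) lmod_nullB lmod_opB lmod_op1 lmod_opM.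

End LmodOps.

Definition lmod_hom (M N : lmodType L) (f : {linear M -> N}) :
    ophom (lmod_op M) (lmod_op N) :=
  @Ophom _ (lmod_op M) (lmod_op N) f (raddfB f) (fun g => linearZ_LR f (scaled 1 g)).

Definition truncate (U : set A) (a : L) : L :=
  \sum_(g <- msupp (a : {malg R[A]}) | g \in U) scaled (a : {malg R[A]})@_g g.

Lemma mcoeff_truncate U a g :
  (truncate U a : {malg R[A]})@_g = if g \in U then (a : {malg R[A]})@_g else 0.
Proof.
rewrite /truncate raddf_sum /= big_mkcond /=.
case: (boolP (g \in msupp (a : {malg R[A]}))) => [ga|ga].
  rewrite (big_fsetD1 g) //= mcoeffUU big1_fset ?addr0 // => h.
  by rewrite in_fsetD1 mcoeffU => /andP[/negPf -> _] _; case: ifP.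
rewrite (mcoeff_outdom ga) if_same big1_fset // => h ha _.
rewrite mcoeffU; case: eqP ha => [->|_ _]; last by case: ifP.
by rewrite (negPf ga).
Qed.

Lemma truncate_is_additive U : zmod_morphism (truncate U).
Proof.
move=> a b; apply/malgP => g; rewrite mcoeff_truncate mcoeffB [RHS]mcoeffB.
by rewrite !mcoeff_truncate; case: ifP => // _; rewrite subr0.
Qed.

HB.instance Definition _ U :=
  GRing.isZmodMorphism.Build L L (truncate U) (truncate_is_additive U).

Lemma truncate_translate g U a :
  truncate (translate g U) (scaled 1 g * a) = scaled 1 g * truncate U a.
Proof.
apply/malgP => h; rewrite mcoeff_scaledM !mcoeff_truncate mcoeff_scaledM.
congr (if _ then _ else _); apply/idP/idP; by rewrite !inE.
Qed.

Lemma truncate_id U a : (forall g, g \in msupp (a : {malg R[A]}) -> U g) -> truncate U a = a.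
Proof.
move=> aU; apply/malgP => g; rewrite mcoeff_truncate.
case: msuppP => [|ga]; last by rewrite if_same.
by move/aU/mem_set ->.
Qed.

Lemma truncate_0 U a : (forall g, g \in msupp (a : {malg R[A]}) -> ~ U g) -> truncate U a = 0.
Proof.
move=> aU; apply/malgP => g; rewrite mcoeff_truncate mcoeff0.
by case: ifP => // /set_mem Ug; apply: mcoeff_outdom; apply/negP => /aU.
Qed.

End GroupElements.

Section ProjectiveGraded.
Variables (R : nzRingType) (A : groupType).
Local Notation L := (group_ring R A).
Variable M : lmodType L.

(** The canonical surjection onto [M] from the free module on the set [M],
    with its coefficients first transformed by [phi]. *)
Definition free_eval (phi : L -> L) (f : {malg L[M]}) : M :=
  \sum_(p <- msupp f) phi f@_p *: p.

Section Eval.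
Variable phi : {additive L -> L}.

Lemma free_evalEw (d : {fset M}) f : (msupp f `<=` d)%fset ->
  free_eval phi f = \sum_(p <- d) phi f@_p *: p.
Proof.
move=> le; apply: big_fset_incl => // p _ /mcoeff_outdom ->.
by rewrite raddf0 scale0r.
Qed.

Lemma free_eval_additive : zmod_morphism (free_eval phi).
Proof.
move=> f g; rewrite (free_evalEw (msuppB_le f g)) (free_evalEw (fsubsetUl _ (msupp g))).
rewrite (free_evalEw (fsubsetUr (msupp f) _)) -sumrB.
by apply: eq_bigr => p _; rewrite mcoeffB raddfB scalerBl.
Qed.

HB.instance Definition _ :=
  GRing.isZmodMorphism.Build {malg L[M]} M (free_eval phi) free_eval_additive.

End Eval.

Lemma free_evalZ (phi psi : {additive L -> L}) a f :
    (forall b, phi (a * b) = a * psi b) ->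
  free_eval phi (a *: f) = a *: free_eval psi f.
Proof.
move=> phiM; rewrite (free_evalEw _ (msuppZ_le a f)) scaler_sumr.
by apply: eq_bigr => p _; rewrite mcoeffZ phiM scalerA.
Qed.

Lemma free_eval_scalable : scalable (free_eval idfun).
Proof. by move=> a f; apply: (@free_evalZ idfun idfun). Qed.

HB.instance Definition _ :=
  GRing.isScalable.Build L {malg L[M]} M _ (free_eval idfun) free_eval_scalable.

Lemma free_eval_onto (x : M) : free_eval idfun << x >> = x.
Proof.
by rewrite (free_evalEw idfun msuppU_le) big_seq_fset1 mcoeffUU /= scale1r.
Qed.

(** A projective [M] is a summand of the free module on the set [M].  The part of
    [x] supported in [U] is obtained by mapping [x] into the free module,
    truncating the coefficients there to [U] and mapping back. *)
Lemma projective_graded : projective M -> graded [set 1%g] (lmod_op M).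
Proof.
move=> /(_ {malg L[M]} M (free_eval idfun) idfun)[|h hK].
  by move=> x; exists << x >>; apply: free_eval_onto.
split; first by move=> g _ _ /= ->; apply: scaler0.
exists (fun U x => free_eval (truncate U) (h x)); split.
- by move=> U x y; rewrite raddfB raddfB.
- move=> g U x /=; rewrite linearZ /=.
  exact/free_evalZ/truncate_translate.
- by move=> U x _ /= ->; rewrite !raddf0.
- move=> x; exists (flatten [seq (msupp ((h x)@_p : {malg R[A]}) : seq A) | p <- msupp (h x)]).
  move=> U; split=> DU /=; rewrite /eqop /=.
    rewrite -[X in _ - X]hK /=; apply/eqP; rewrite subr_eq0; apply/eqP.
    apply: eq_big_seq => p hp; rewrite truncate_id // => g hg.
    by apply: DU; apply/flatten_mapP; exists p.
  rewrite /free_eval big_seq big1 // => p hp; rewrite truncate_0 ?scale0r // => g hg.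
  by apply: DU; apply/flatten_mapP; exists p.
Qed.

End ProjectiveGraded.

(** A resolution of length [n] would make the trivial module, all of which is
    invariant, have no nonzero invariants. *)
Theorem infinite_chain_cd (R : nzRingType) (A : groupType) (Xs : seq (seq A)) n :
  infinite_chain [set 1%g] Xs -> (n < size Xs)%N -> ~ cd_le R A n.
Proof.
move=> chainXs lt_n [P [d [e [prP onto ex0 exS P0]]]].
have sub1 : subgroup [set 1%g : A].
  by split=> [|x y -> ->]; rewrite /= ?invg1 ?mulg1.
have resP : resolution (fun i => lmod_hom (d i)) (lmod_hom e).
  split=> [y|x|i x].
  - by have [x <-] := onto y; exists x; exact: subrr.
  - rewrite /= ex0; split=> -[y]; first by move=> <-; exists y; exact: subrr.
    by move=> /eqP; rewrite subr_eq0 => /eqP ->; exists y.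
  - rewrite /= exS; split=> -[y]; first by move=> <-; exists y; exact: subrr.
    by move=> /eqP; rewrite subr_eq0 => /eqP ->; exists y.
have := resolution_invariant sub1 chainXs resP (fun i => projective_graded (prP i)).
have st : stable (lmod_op (trivial_module R A)) (centralizer [set 1%g]).
  by move=> g x _ /= ->; apply: scaler0.
have P0' : forall i, (size Xs <= i)%N -> forall x : lmod_op (P i), null x.
  by move=> i le_i x; apply: P0; apply: leq_trans le_i.
move=> /(_ st P0' (1 : R)) H.
have /eqP : (1 : R) = 0; last by rewrite oner_eq0.
apply: H => X _ s _; rewrite /eqop /=.
have -> : scaled 1 s *: (1 : trivial_module R A) = 1 :> R.
  by rewrite /GRing.scale /= /triv_scale augmentation_scaled mulr1.
exact: subrr.
Qed.

(** * Countable locally finite groups *)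

(** A countable form of the dual basis lemma.  Think of [I] as the union of an
    increasing sequence of left ideals generated by idempotents [f_i = c (v_i)]
    with [f_i f_(i+1) = f_i].  A map out of [I] is a sequence of images [u_i] of the
    generators with [f_i u_(i+1) = f_i u_i], and such a sequence can be lifted
    along a surjection one step at a time: correct the previous value by
    [(f_(i+1) - f_i) m_(i+1)], where [m_(i+1)] is an arbitrary lift. *)
Lemma projective_dual_sequence (L : nzRingType) (I : lmodType L)
    (c : {linear I -> L^o}) (v : nat -> I) :
    (forall i j, (i <= j)%N -> (c (v i) : L) *: v j = v i) ->
    (forall x, exists i, (c x : L) *: v i = x) ->
  projective I.
Proof.
move=> vv cv M N f g fonto; have [m fm] := choice (fun i => fonto (g (v i))).
pose u := fix u i := if i is j.+1
  then u j + ((c (v j.+1) : L) - (c (v j) : L)) *: m j.+1 else m 0.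
have fu i : f (u i) = g (v i).
  elim: i => [|i IH] /=; first exact: fm.
  rewrite linearD linearZ /= IH fm -linearZ scalerBl !vv //=.
  by rewrite linearB /= addrC subrK.
have cc i j : (i <= j)%N -> (c (v i) : L) * (c (v j) : L) = c (v i).
  by move=> /vv vij; rewrite -[in RHS]vij linearZ.
have cu i j : (i <= j)%N -> (c (v i) : L) *: u j = (c (v i) : L) *: u i.
  elim: j => [|j IH]; first by rewrite leqn0 => /eqP ->.
  rewrite leq_eqVlt => /orP[/eqP <- //|lt_ij] /=.
  rewrite scalerDr scalerA mulrBr cc; last exact: ltnW.
  by rewrite cc // subrr scale0r addr0 IH.
pose idx x := sval (cid (cv x)).
have idxP x : (c x : L) *: v (idx x) = x := svalP (cid (cv x)).
pose h x := (c x : L) *: u (idx x).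
have cidx x : (c x : L) = (c x : L) * (c (v (idx x)) : L).
  by rewrite -[in LHS](idxP x) linearZ.
have hE x j : (idx x <= j)%N -> h x = (c x : L) *: u j.
  by move=> le_j; rewrite /h cidx -[LHS]scalerA -[RHS]scalerA cu.
have h_linear : linear h.
  move=> a x y; set k := maxn (idx (a *: x + y)) (maxn (idx x) (idx y)).
  rewrite !(@hE _ k) ?leq_max ?leqnn ?orbT //.
  by rewrite linearP scalerDl scalerA.
pose hL := GRing.isLinear.Build L I M _ h h_linear.
exists (HB.pack h hL : {linear I -> M}) => x /=.
by rewrite /h linearZ /= fu -linearZ /= idxP.
Qed.

Section AugmentationIdeal.
Variables (R : nzRingType) (A : groupType).
Local Notation L := (group_ring R A).

Definition in_augmentation_ideal : {pred L^o} := fun x => augmentation (x : L) == 0.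

Lemma augmentation0 : augmentation (0 : L) = 0.
Proof. by rewrite /augmentation msupp0 big_seq_fset0. Qed.

Lemma augmentation_ideal_closed : subsemimod_closed in_augmentation_ideal.
Proof.
split; first split; rewrite ?unfold_in /= ?augmentation0 ?eqxx //.
  move=> x y; rewrite !unfold_in => /eqP x0 /eqP y0.
  by rewrite augmentationD x0 y0 addr0.
move=> a x; rewrite !unfold_in => /eqP x0.
by rewrite augmentationM x0 mulr0.
Qed.

Definition augmentation_ideal : Type := {x : L^o | in_augmentation_ideal x}.

HB.instance Definition _ := SubChoice.on augmentation_ideal.
HB.instance Definition _ :=
  GRing.SubChoice_isSubLmodule.Build L L^o in_augmentation_ideal
    augmentation_ideal augmentation_ideal_closed.

Definition augmentation_map (x : L^o) : trivial_module R A := augmentation (x : L).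

Lemma augmentation_linear : linear augmentation_map.
Proof. by move=> a x y; rewrite /augmentation_map augmentationD augmentationM. Qed.

HB.instance Definition _ := GRing.isLinear.Build L L^o (trivial_module R A) _
  augmentation_map augmentation_linear.

Definition augmentation_ideal_val (x : augmentation_ideal) : L^o := \val x.

Lemma augmentation_ideal_val_linear : linear augmentation_ideal_val.
Proof. by []. Qed.

HB.instance Definition _ := GRing.isLinear.Build L augmentation_ideal L^o _
  augmentation_ideal_val augmentation_ideal_val_linear.

(** The complex [0 -> I -> L -> R -> 0] of the augmentation ideal [I], padded by
    the zero module of row vectors of length zero. *)
Definition augmentation_degree (i : nat) : lmodType L :=
  match i with 0 => L^o | 1 => augmentation_ideal | _ => 'rV[L]_0 end.

Definition augmentation_d (i : nat) :
    {linear augmentation_degree i.+1 -> augmentation_degree i} :=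
  match i with
  | 0 => augmentation_ideal_val
  | j.+1 => (\0 : {linear augmentation_degree j.+2 -> augmentation_degree j.+1})
  end.

Lemma projective_regular : projective (L^o : lmodType L).
Proof.
apply: (projective_dual_sequence (c := idfun) (v := fun=> 1)) => [i j _|x].
  by rewrite scale1r.
by exists 0; rewrite /GRing.scale /= mulr1.
Qed.

Lemma projective_zero : projective ('rV[L]_0 : lmodType L).
Proof.
apply: (projective_dual_sequence (c := \0) (v := fun=> 0)) => [i j _|x].
  by rewrite scaler0.
by exists 0; rewrite scaler0 [RHS]thinmx0.
Qed.

Lemma augmentation_resolution :
  projective (augmentation_ideal : lmodType L) -> cd_le R A 1.
Proof.
move=> prI; exists augmentation_degree, augmentation_d, augmentation_map; split.
- by case=> [|[|i]]; [exact: projective_regular | | exact: projective_zero].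
- by move=> y; exists (scaled (y : R) 1%g); apply: augmentation_scaled.
- move=> x; split=> [x0|[y <-]].
    have Ix : in_augmentation_ideal x by apply/eqP.
    by exists (Sub x Ix : augmentation_ideal); apply: SubK.
  exact/eqP/(valP y).
- case=> [|i] x; split=> [x0|[y <-]] //.
    by exists 0; rewrite linear0; apply: val_inj; exact: (esym x0).
  exists 0; rewrite linear0; case: i x x0 => [|i] x _; exact/esym/thinmx0.
- by case=> [|[|i]] //= _ x; apply: thinmx0.
Qed.

End AugmentationIdeal.

Section Average.
Variables (R : numFieldType) (A : groupType).
Local Notation L := (group_ring R A).
Implicit Types (H : set A) (F : seq A).

(** The idempotent of a finite subgroup, enumerated by [F]. *)
Definition average F : L := \sum_(h <- F) scaled ((size F)%:R^-1) h.

Lemma augmentation_average F : (0 < size F)%N -> augmentation (average F) = 1.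
Proof.
move=> F0; rewrite augmentation_sum (eq_bigr (fun=> (size F)%:R^-1)).
  by rewrite big_const_seq count_predT iter_addr_0 -[_ *+ size F]mulr_natl mulfV // Num.Theory.pnatr_eq0 -lt0n.
by move=> h _; apply: augmentation_scaled.
Qed.

(** The average over a finite subgroup absorbs each of its elements. *)
Lemma mulr_average H F (x : L) : subgroup H -> uniq F -> [set` F] = H ->
    (forall g, g \in msupp (x : {malg R[A]}) -> H g) ->
  x * average F = scaled (augmentation x) 1%g * average F.
Proof.
move=> sH uF FH xH; have inF g : g \in F <-> H g by rewrite -FH.
have key g c : H g -> scaled c g * average F = scaled c 1%g * average F.
  move=> Hg; rewrite /average !mulr_sumr.
  under eq_bigr do rewrite scaledM.
  under [RHS]eq_bigr do rewrite scaledM mul1g.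
  rewrite -(big_map (fun h => g * h)%g xpredT (fun h => scaled (c * (size F)%:R^-1) h)).
  apply: perm_big; apply: uniq_perm => //.
    by rewrite map_inj_uniq //; apply: mulgI.
  move=> h; apply/mapP/idP => [[k /inF Hk ->]|/inF Hh].
    by apply/inF; apply: subgroupM.
  exists (g^-1 * h)%g; last by rewrite mulVKg.
  by apply/inF; apply: subgroupM => //; apply: subgroupV.
rewrite {1}(group_ringE x) mulr_suml /augmentation.
rewrite (big_morph (fun c => scaled c 1%g) (fun a b => scaledD a b _) (monalgU0 _)).
rewrite mulr_suml; apply: eq_big_seq => g xg; apply: key; exact: xH.
Qed.

(** Write the group as the increasing union of finite subgroups [H i] with averages
    [e i].  The augmentation ideal is the union of the left ideals generated by
    the idempotents [1 - e i]: an element of augmentation zero supported in [H i]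
    is killed by [e i] from the right.  It is therefore projective. *)
Theorem locally_finite_cd (enum : nat -> A) :
    (forall a, exists i, enum i = a) ->
    (forall X : seq A, finite_set (generated [set` X])) ->
  cd_le R A 1.
Proof.
move=> enumP lf; apply: augmentation_resolution.
pose H i := generated [set` [seq enum j | j <- iota 0 i]].
have sH i : subgroup (H i) by apply: generated_subgroup.
have Hle i j : (i <= j)%N -> H i `<=` H j.
  move=> le_ij; apply: generatedS => x /mapP[k]; rewrite mem_iota => /andP[_ ki] ->.
  by apply: map_f; rewrite mem_iota /= (leq_trans ki).
have /choice[F FP] i : exists F : seq A, uniq F /\ [set` F] = H i.
  have /finite_seqP[s Hs] := lf [seq enum j | j <- iota 0 i].
  exists (undup s); split; first exact: undup_uniq.
  by rewrite /H Hs; apply/seteqP; split=> x /=; rewrite mem_undup.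
have F0 i : (0 < size (F i))%N.
  have : 1%g \in F i by change ([set` F i] 1%g); rewrite (FP i).2; apply: (sH i).1.
  by case: (F i).
pose e i : L := average (F i).
have he i j (x : L) : (i <= j)%N -> (forall g, g \in msupp (x : {malg R[A]}) -> H i g) ->
    x * e j = scaled (augmentation x) 1%g * e j.
  move=> le_ij xH; apply: (mulr_average (sH j)) (FP j).1 (FP j).2 _ => g /xH.
  exact: Hle.
have supp_e i g : g \in msupp (e i : {malg R[A]}) -> H i g.
  rewrite -(FP i).2 /=; apply: contraTT => gF; rewrite -mcoeff_eq0 raddf_sum /=.
  rewrite big_seq big1 // => h hF; rewrite mcoeffU; case: eqP => // hg.
  by rewrite -hg hF in gF.
have aug_e i : augmentation (e i) = 1 by apply: augmentation_average.
have e0 i : in_augmentation_ideal (1 - e i : L).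
  have := augmentationD (1 - e i) (e i).
  by rewrite subrK augmentation1 aug_e => /esym/(canRL (addrK _)); rewrite subrr => /eqP.
pose v i : augmentation_ideal R A := Sub (1 - e i : L^o) (e0 i).
have valv i : augmentation_ideal_val (v i) = 1 - e i :> L by apply: SubK.
have valZ (a : L) (y : augmentation_ideal R A) :
    \val (a *: y) = (a * augmentation_ideal_val y : L) :> L^o by [].
apply: (projective_dual_sequence (c := @augmentation_ideal_val R A) (v := v)).
  move=> i j le_ij; apply: val_inj; rewrite valZ -[RHS]/(augmentation_ideal_val _).
  rewrite !valv mulrBr mulr1 mulrBl mul1r (he i) //; last exact: supp_e.
  by rewrite aug_e [scaled _ _ * _]mul1r subrr subr0.
move=> x; pose s : seq A := msupp ((\val x : L) : {malg R[A]}).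
have [i sH'] : exists i, forall g, g \in s -> H i g.
  elim: s => [|g s [i IH]]; first by exists 0.
  have [j gj] := enumP g; exists (maxn i j.+1) => h; rewrite inE => /orP[/eqP ->|/IH].
    apply: generated_sub; rewrite -gj /=; apply: map_f.
    by rewrite mem_iota /= leq_max leqnn orbT.
  by apply: Hle; rewrite leq_maxl.
exists i; apply: val_inj; rewrite valZ valv mulrBr mulr1 (he i) //.
have /eqP -> : augmentation (augmentation_ideal_val x : L) == 0 := valP x.
by rewrite /scaled monalgU0 mul0r subr0.
Qed.

End Average.

(** * Finitely generated groups *)

Section FiniteIndex.
Local Open Scope group_scope.
Variable A : groupType.
Implicit Types (K G C : set A) (X T : seq A).

(** The representatives are taken in [C] rather than [G] so that the Schreier
    generators built from them stay in the group [C]. *)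
Lemma finite_index_cover K G C : subgroup K -> C `<=` G -> finite_index K G ->
  exists T, [set` T] `<=` C /\
    forall g, C g -> exists2 t, t \in T & K (t^-1 * g).
Proof.
move=> sK CG; pose coset g := [set g * k | k in K].
have self g : coset g g by exists 1; rewrite ?mulg1 //; apply: sK.1.
have CGi : coset @` C `<=` coset @` G by apply: image_subset.
move=> /(sub_finite_set CGi) /finite_seqP[s sE].
have /choice[r rP] (U : set A) : exists t, U \in s -> C t /\ coset t = U.
  have [Us|_] := boolP (U \in s); last by exists 1.
  have [t Ct <-] : (coset @` C) U by rewrite sE.
  by exists t.
exists (map r s); split=> [t /mapP[U /rP[Ct _] ->] //|g Cg].
have sg : coset g \in s by change ([set` s] (coset g)); rewrite -sE; exists g.
exists (r (coset g)); first exact: map_f.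
have [_ e] := rP _ sg; have [k Kk ek] : coset (r (coset g)) g by rewrite e.
by rewrite -[X in _ * X]ek mulKg.
Qed.

(** The Schreier generators [r (x t)^-1 x t] generate a subgroup [E] for which the
    union of the cosets [t E] is stable under left multiplication by [X] and its
    inverses. *)
Lemma schreier K X T : subgroup K ->
    [set` T] `<=` generated [set` X] ->
    (forall g, generated [set` X] g -> exists2 t, t \in T & K (t^-1 * g)) ->
  exists E : seq A, [/\ [set` E] `<=` K, [set` E] `<=` generated [set` X] &
    forall g, generated [set` X] g ->
      exists2 t, t \in T & generated [set` E] (t^-1 * g)].
Proof.
move=> sK TX cov; set G := generated [set` X].
have sG : subgroup G by apply: generated_subgroup.
have /choice[r rP] g : exists t, G g -> t \in T /\ K (t^-1 * g).
  have [/cov[t Tt Kt]|nG] := pselect (G g); last by exists 1.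
  by exists t.
pose X' := X ++ [seq x^-1 | x <- X].
have GX' x : x \in X' -> G x.
  rewrite mem_cat => /orP[Xx|/mapP[y Xy ->]]; first exact: generated_sub.
  exact: (subgroupV sG (generated_sub Xy)).
pose step g := (r g)^-1 * g.
(* [step 1] accounts for the representative of the trivial coset not being [1] *)
pose E := step 1 :: [seq step (x * t) | x <- X', t <- T].
have EG g : G g -> K (step g) /\ G (step g).
  move=> Gg; have [Tr Kr] := rP g Gg; split=> //.
  exact: (subgroupM sG (subgroupV sG (TX _ Tr)) Gg).
have Exp e : e \in E -> exists2 g, G g & e = step g.
  rewrite inE => /orP[/eqP ->|/allpairsP[[x t] /= [X'x Tt ->]]].
    by exists 1 => //; apply: sG.1.
  by exists (x * t) => //; exact: (subgroupM sG (GX' _ X'x) (TX _ Tt)).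
exists E; split=> [e /Exp[g /EG[Kg _] ->] //|e /Exp[g /EG[_ Gg] ->] //|].
have sE : subgroup (generated [set` E]) by apply: generated_subgroup.
pose S := [set g | exists2 t, t \in T & generated [set` E] (t^-1 * g)].
have XS x g : x \in X' -> S g -> S (x * g).
  move=> X'x [t Tt Et]; have Gxt : G (x * t).
    exact: (subgroupM sG (GX' _ X'x) (TX _ Tt)).
  exists (r (x * t)); first by case: (rP _ Gxt).
  have -> : (r (x * t))^-1 * (x * g) = step (x * t) * (t^-1 * g).
    by rewrite /step !mulgA mulgK.
  apply: (subgroupM sE _ Et); apply: generated_sub; rewrite /= inE.
  by apply/orP; right; apply: allpairs_f.
have S1 : S 1.
  have [Tr _] := rP 1 sG.1; exists (r 1) => //.
  by apply: generated_sub; rewrite /= inE eqxx.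
suff GS g : G g -> forall s, S s -> S (g * s) /\ S (g^-1 * s).
  by move=> g /GS/(_ 1 S1)[]; rewrite mulg1.
move: g; apply: generated_min => [|x Xx s Ss].
  split=> [s Ss|x y Gx Gy s Ss]; first by rewrite invg1 mul1g.
  split; first by rewrite -mulgA; apply: (Gx _ _).1; apply: (Gy _ _).2.
  by rewrite invgF -mulgA; apply: (Gy _ _).1; apply: (Gx _ _).2.
by split; apply: XS; rewrite // mem_cat ?map_f ?orbT // [x \in X]Xx.
Qed.

(** Finite generation of subgroups of finite index, in the form in which it
    applies to the intersection of [K] with a group smaller than [G]. *)
Lemma infinite_fg_finite_index K G X : subgroup K -> finite_index K G ->
    generated [set` X] `<=` G -> infinite_set (generated [set` X]) ->
  exists E : seq A, [/\ [set` E] `<=` K, [set` E] `<=` generated [set` X] &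
    infinite_set (generated [set` E])].
Proof.
move=> sK fK XG infX; have [T [TX cov]] := finite_index_cover sK XG fK.
have [E [EK EX covE]] := schreier sK TX cov.
exists E; split=> // finE; apply: infX.
apply: (@sub_finite_set _ _ (\bigcup_(t in [set` T]) ((fun e => t * e) @` generated [set` E]))).
  move=> g /covE[t Tt Et]; exists t => //; exists (t^-1 * g) => //.
  by rewrite mulVKg.
apply: bigcup_finite => [|t _]; first exact: finite_seq.
exact: finite_image.
Qed.

Lemma generated_countable X : exists f : nat -> A, generated [set` X] `<=` range f.
Proof.
pose letter (l : 'I_(size X) * bool) :=
  let x := nth 1 X l.1 in if l.2 then x^-1 else x.
pose word (w : seq ('I_(size X) * bool)) := foldr (fun l g => letter l * g) 1 w.
pose f i : A := oapp word 1 (choice.unpickle i).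
exists f; have wf w : range f (word w).
  by exists (choice.pickle w) => //; rewrite /f choice.pickleK.
suff : generated [set` X] `<=` range word by move=> XW g /XW[w _ <-].
have wM u w : word u * word w = word (u ++ w).
  by elim: u => [|l u IH] /=; rewrite ?mul1g // -mulgA IH.
have wV u : exists w, (word u)^-1 = word w.
  elim: u => [|[i b] u [w ew]]; first by exists [::]; rewrite /= invg1.
  exists (w ++ [:: (i, ~~ b)]); rewrite -wM -ew /= mulg1 invgM /letter /=.
  by case: b => /=; rewrite ?invgK.
apply: generated_min.
  split=> [|_ _ [u _ <-] [w _ <-]]; first by exists [::].
  by have [w' ->] := wV w; exists (u ++ w').
move=> x /= Xx; have lt_x : (index x X < size X)%N by rewrite index_mem.
by exists [:: (Ordinal lt_x, false)]; rewrite //= mulg1 /letter /= nth_index.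
Qed.

End FiniteIndex.

Section SubgroupType.
Local Open Scope group_scope.
Variables (A : groupType) (H : groupClosed A).
Local Notation S := (subgroup_type H).

Lemma val_generated (X : seq S) :
  generated [set` map val X] = val @` generated [set` X].
Proof.
apply/seteqP; split; last first.
  move=> _ [x Gx <-]; move: x Gx.
  apply: generated_min => [|x /= Xx]; last exact/generated_sub/map_f.
  split; first exact: (generated_subgroup _).1.
  by move=> x y /=; apply: (generated_subgroup _).2.
apply: generated_min => [|_ /mapP[x Xx ->]]; last first.
  by exists x => //; apply: generated_sub.
split; first by exists 1 => //; apply: (generated_subgroup _).1.
move=> _ _ [x Gx <-] [y Gy <-]; exists (x / y) => //.
exact: (generated_subgroup _).2.
Qed.

(** Being a chain only involves the subgroups generated by the lists, so it can be
    checked in the ambient group. *)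
Lemma infinite_chain_val (Xs : seq (seq S)) (B : set A) :
  infinite_chain B (map (map val) Xs) -> infinite_chain (val @^-1` B) Xs.
Proof.
elim: Xs B => [//|X Xs IH] B [infX XB cX [B' [sB' BB' XB' /IH chX]]].
have valX (a : S) : generated [set` X] a -> generated [set` map val X] (val a).
  by move=> Xa; rewrite val_generated; exists a.
split.
- by move=> finX; apply: infX; rewrite val_generated; apply: finite_image.
- by move=> a /valX Xa Ba; apply: val_inj; apply: XB Xa Ba.
- by move=> a /valX /cX ca b /= /ca ab; apply: val_inj.
- exists (val @^-1` B'); split=> //.
  + by split=> [|x y]; [exact: sB'.1 | exact: sB'.2].
  + by move=> x /BB'.
  + by move=> x Xx; apply: XB'; apply: map_f.
Qed.

Lemma lift_subgroup (X : seq A) : [set` X] `<=` [set` H] ->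
  exists Y : seq S, map val Y = X.
Proof.
elim: X => [|x X IH] XH; first by exists [::].
have [Y <-] := IH (fun y Xy => XH y (mem_behead (s := x :: X) Xy)).
by exists (Sub x (XH x (mem_head x X)) :: Y).
Qed.

End SubgroupType.

Lemma finite_set_injective_image (T U : Type) (f : T -> U) (S : set T) :
    (forall x y, S x -> S y -> f x = f y -> x = y) -> finite_set (f @` S) ->
  finite_set S.
Proof.
move=> injf finf; have [[x0 Sx0]|S0] := pselect (exists x, S x); last first.
  by apply: (@sub_finite_set _ _ set0) => // x Sx; apply: S0; exists x.
have /choice[g gP] (u : U) : exists x, (f @` S) u -> S x /\ f x = u.
  have [[x Sx <-]|nu] := pselect ((f @` S) u); first by exists x.
  by exists x0 => /nu.
apply: sub_finite_set (finite_image g finf) => x Sx.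
have [Sg fg] := gP (f x) (ex_intro2 _ _ x Sx erefl).
by exists (f x); [exists x | apply: injf].
Qed.

(** * Automorphisms of rooted trees *)

Section Automorphisms.
Local Open Scope group_scope.
Variable d : nat.
Implicit Types (f g h : tree_aut d) (u v w : seq 'I_d) (U V : set (seq 'I_d)).

Lemma tree_autM f g w : (f * g) w = f (g w). Proof. by []. Qed.
Lemma tree_autK f : cancel f (f^-1)%g. Proof. exact: aut_funK. Qed.
Lemma tree_autVK f : cancel (f^-1)%g f. Proof. exact: aut_invK. Qed.

Lemma tree_aut_inj f : injective f. Proof. exact: can_inj (tree_autK f). Qed.

Lemma eq_cat_aut f v w v' w' : size v' = size v -> f (v ++ w) = v' ++ w' ->
  f v = v' /\ section f v w = w'.
Proof.
move=> sv; rewrite sectionE => /eqP; rewrite eqseq_cat ?size_aut ?sv //.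
by case/andP => /eqP -> /eqP ->.
Qed.

Lemma sectionM f g v : section (f * g) v = section f (g v) * section g v.
Proof.
apply: tree_autP => w; rewrite tree_autM.
have e : (f * g) (v ++ w) = f (g v) ++ section f (g v) (section g v w).
  by rewrite tree_autM !sectionE.
by have [|_ ->] := eq_cat_aut _ e; rewrite ?size_aut.
Qed.

Lemma section1 v : section 1 v = 1 :> tree_aut d.
Proof. by apply: tree_autP => w; have [] := @eq_cat_aut 1 v w v w erefl erefl. Qed.

Lemma sectionV f v : f v = v -> section f^-1 v = (section f v)^-1.
Proof.
move=> fv; apply: (mulIg (section f v)).
by rewrite mulVg -{1}fv -sectionM mulVg section1.
Qed.

Lemma tree_aut_prefix f v w : prefix (f v) (f w) = prefix v w.
Proof.
have h g v' w' : prefix v' w' -> prefix (g v') (g w').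
  by case/prefixP => u ->; rewrite sectionE prefix_prefix.
by apply/idP/idP => [/(h f^-1)|/h //]; rewrite !tree_autK.
Qed.

Lemma fix_prefix f v w : prefix v w -> f w = w -> f v = v.
Proof. by case/prefixP => u -> fw; case: (eq_cat_aut erefl fw). Qed.

Definition subtree v : set (seq 'I_d) := [set w | prefix v w].

Lemma subtree_disjoint v v' w w' :
  size v = size v' -> v <> v' -> prefix v w -> prefix v' w' ->
  subtree w `&` subtree w' = set0.
Proof.
move=> sv vv' pw pw'; apply/seteqP; split=> // u [/= wu wu']; apply: vv'.
have := prefix_trans pw wu; have := prefix_trans pw' wu'.
by rewrite !prefixE sv => /eqP e' /eqP e; rewrite -e e'.
Qed.

Definition supported_on U : set (tree_aut d) := [set g | forall w, ~ U w -> g w = w].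

Lemma supported_on_subgroup U : subgroup (supported_on U).
Proof.
split=> [w _ //|f g sf sg w Uw]; rewrite tree_autM.
have -> : g^-1 w = w by rewrite -{1}(sg w Uw) tree_autK.
exact: sf.
Qed.

Lemma supported_onS U V : U `<=` V -> supported_on U `<=` supported_on V.
Proof. by move=> UV g sg w Vw; apply: sg => /UV. Qed.

Lemma supported_on_stable U g w : supported_on U g -> U w -> U (g w).
Proof.
move=> sg Uw; apply: contrapT => Ugw; have := sg _ Ugw.
by move/tree_aut_inj => gw; rewrite gw in Ugw.
Qed.

Lemma supported_on0 g : supported_on set0 g -> g = 1.
Proof. by move=> sg; apply: tree_autP => w; apply: sg. Qed.

Lemma supported_onI U V g : supported_on U g -> supported_on V g -> supported_on (U `&` V) g.
Proof.
move=> sU sV w nw; have [Uw|] := pselect (U w); last exact: sU.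
by apply: sV => Vw; apply: nw.
Qed.

Lemma supported_on_commute U V f g : U `&` V = set0 ->
  supported_on U f -> supported_on V g -> f * g = g * f.
Proof.
move=> UV sf sg; apply: tree_autP => w; rewrite !tree_autM.
have UVw u : U u -> V u -> False by move=> Uu Vu; rewrite -[False]/(set0 u) -UV.
have [Uw|Uw] := pselect (U w).
  rewrite (sg w); last exact: UVw.
  by rewrite sg //; apply: UVw; apply: supported_on_stable.
rewrite (sf w Uw); have [Vw|Vw] := pselect (V w); last by rewrite !(sg w, sf w).
by rewrite sf // => Ugw; apply: UVw Ugw _; apply: supported_on_stable.
Qed.

Lemma supported_on_conj v f g : supported_on (subtree v) g ->
  supported_on (subtree (f v)) (f * g * f^-1).
Proof.
move=> sg w nw; rewrite !tree_autM sg ?tree_autVK // => vw.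
by apply: nw; rewrite /subtree /= -(tree_autVK f w) tree_aut_prefix.
Qed.

(** The image of [v] has the same length, so it lies in the subtree only if it is [v]. *)
Lemma supported_on_fix v g : supported_on (subtree v) g -> g v = v.
Proof.
move=> sg; have := supported_on_stable sg (prefix_refl v).
by rewrite /subtree /= prefixE take_oversize ?size_aut // => /eqP.
Qed.

Lemma RistE (G : groupClosed (tree_aut d)) v g :
  Rist G v g <-> g \in G /\ supported_on (subtree v) g.
Proof.
by split=> -[Gg sg]; split=> // w vw; apply: sg; [move/negP: vw | apply/negP].
Qed.

Lemma Rist_subgroup (G : groupClosed (tree_aut d)) v : subgroup (Rist G v).
Proof.
split=> [|f g /RistE[Gf sf] /RistE[Gg sg]]; apply/RistE.
  by split; [exact: gpred1 | exact: (supported_on_subgroup _).1].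
by split; [exact: gpredF | exact: (supported_on_subgroup _).2].
Qed.

Lemma Stab_subgroup (H : groupClosed (tree_aut d)) V : subgroup (Stab H V).
Proof.
split=> [|f g [Hf fV] [Hg gV]]; first by split=> //; apply: gpred1.
split=> [|v Vv]; first exact: gpredF.
by rewrite tree_autM -{1}(gV v Vv) tree_autK fV.
Qed.

Lemma section_subgroup v (K : set (tree_aut d)) : subgroup K ->
  (forall k, K k -> k v = v) -> subgroup [set section k v | k in K].
Proof.
move=> sK Kv; split; first by exists 1; [exact: sK.1 | exact: section1].
move=> _ _ [f Kf <-] [g Kg <-]; exists (f / g); first exact: sK.2.
rewrite sectionM (sectionV (Kv g Kg)) (Kv _ (subgroupV sK Kg)) //.
Qed.

(** There are finitely many actions on the words of length [N], and the action on
    shorter words is determined by them. *)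
Lemma infinite_agree (S : set (tree_aut d)) N : infinite_set S ->
  exists f g, [/\ S f, S g, f <> g & forall w, (size w <= N)%N -> f w = g w].
Proof.
move=> infS; apply: contrapT => none; apply: infS.
pose F f : {ffun N.-tuple 'I_d -> N.-tuple 'I_d} := [ffun t : N.-tuple 'I_d => insubd t (f t)].
have FE f (t : N.-tuple 'I_d) : F f t = f t :> seq _.
  by rewrite ffunE val_insubd size_aut size_tuple eqxx.
apply: (finite_set_injective_image (f := F)); last first.
  exact: finite_finset.
move=> f g Sf Sg eF; apply: contrapT => nfg; apply: none; exists f, g; split=> // w sw.
case: w sw => [|i w' sw]; first by rewrite !aut_root.
set w := i :: w' in sw *; pose u := w ++ nseq (N - size w) i.
have su : size u == N by rewrite size_cat size_nseq subnKC.
have := congr1 (fun F : {ffun _ -> _} => val (F (Tuple su))) eF.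
rewrite /= !FE /= => /eqP; rewrite [g u]sectionE => /eqP.
by case/eq_cat_aut; rewrite ?size_aut.
Qed.

End Automorphisms.

(** * Transversals *)

Section Transversals.
Variables (d : nat) (X : set (seq 'I_d)).
Hypothesis trX : tree_transversal X.
Implicit Types (u v w : seq 'I_d).

Lemma transversal_comparable (i0 : 'I_d) w :
  exists2 x, X x & prefix x w || prefix w x.
Proof.
have [x [[Xx [n xn]] _]] := trX (nth i0 w); exists x => //.
have pre m k : (m <= k)%N -> prefix (mkseq (nth i0 w) m) (mkseq (nth i0 w) k).
  move=> le_mk; rewrite prefixE size_mkseq; apply/eqP.
  by rewrite /mkseq -map_take take_iota; congr map; congr iota; apply/minn_idPl.
rewrite xn -{2 3}[w](mkseq_nth i0).
by have [/pre ->|/ltnW/pre ->] := leqP n (size w); rewrite ?orbT.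
Qed.

Lemma transversal_antichain (i0 : 'I_d) x y : X x -> X y -> prefix x y -> x = y.
Proof.
move=> Xx Xy /prefixP[u yE]; have [z [_ uz]] := trX (nth i0 y).
transitivity z; [symmetry|]; apply: uz; split=> //; last first.
  by exists (size y); rewrite mkseq_nth.
exists (size x); apply: (@eq_from_nth _ i0); rewrite ?size_mkseq // => i lt_i.
by rewrite nth_mkseq // yE nth_cat lt_i.
Qed.

(** Koenig's lemma: call [u] bad if it has arbitrarily long extensions without a
    prefix in [X].  One of the finitely many children of a bad word is bad, so if
    the root were bad there would be a ray of bad words, but this ray meets [X]. *)
Lemma transversal_depth : exists N, forall w, size w = N -> exists2 x, X x & prefix x w.
Proof.
pose bad u := forall n, exists w, size w = n /\ forall x, X x -> ~ prefix x (u ++ w).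
have [[N good]|bad0] : (exists N, forall w, size w = N -> exists2 x, X x & prefix x w) \/ bad [::].
- have [|ng] := pselect (exists N, forall w, size w = N -> exists2 x, X x & prefix x w).
    by left.
  right=> n; apply: contrapT => nw; apply: ng; exists n => w sw.
  apply: contrapT => nx; apply: nw; exists w; split=> // x Xx xw; apply: nx.
  by exists x.
- by exists N.
have step u : bad u -> exists i, bad (rcons u i).
  move=> badu; apply: contrapT => nobad.
  have /choice[n nP] i : exists n, forall w, size w = n ->
      exists2 x, X x & prefix x (rcons u i ++ w).
    apply: contrapT => ni; apply: nobad; exists i => n.
    apply: contrapT => nw; apply: ni; exists n => w sw.
    apply: contrapT => nx; apply: nw; exists w; split=> // x Xx xw; apply: nx.
    by exists x.
  have [[|i w] [//= [sw] wX]] := badu (\max_i n i).+1.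
  have [|x Xx] := nP i (take (n i) w).
    by rewrite size_takel // sw; apply: leq_bigmax.
  move=> xw; apply: (wX x Xx); apply: prefix_trans xw _.
  by rewrite cat_rcons -{2}[w](cat_take_drop (n i)) -cat_cons catA prefix_prefix.
have [i0 _] := step _ bad0.
have /choice[next nextP] u : exists i, bad u -> bad (rcons u i).
  have [/step[i ?]|nb] := pselect (bad u); first by exists i.
  by exists i0 => /nb.
pose v := fix v n := if n is m.+1 then rcons (v m) (next (v m)) else [::].
have badv n : bad (v n) by elim: n => //= n IH; apply: nextP.
have vE n : mkseq (fun k => next (v k)) n = v n.
  elim: n => [//|n IH] /=.
  by rewrite mkseqS IH.
have [x [[Xx [n xn]] _]] := trX (fun k => next (v k)).
have [w [_ /(_ x Xx)]] := badv n 0.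
by rewrite xn vE prefix_prefix.
Qed.

(** A longer vertex of [X] would have another vertex of [X] as a proper prefix, and
    some ray would pass through both. *)
Lemma transversal_bounded (i0 : 'I_d) : exists N, forall x, X x -> (size x <= N)%N.
Proof.
have [N NP] := transversal_depth; exists N => x Xx.
rewrite leqNgt; apply/negP => lt_Nx.
have [|y Xy yx] := NP (take N x); first by rewrite size_takel // ltnW.
have yx' : prefix y x by apply: prefix_trans yx _; apply: prefix_take.
have sy : (size y <= N)%N.
  by rewrite (leq_trans (size_prefix yx)) // size_take_min geq_minl.
by move: lt_Nx; rewrite ltnNge -(transversal_antichain i0 Xy Xx yx') sy.
Qed.

Lemma finite_words N : finite_set [set w : seq 'I_d | (size w <= N)%N].
Proof.
apply: (@sub_finite_set _ _ (\bigcup_(n in `I_N.+1) range (fun t : n.-tuple 'I_d => val t))).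
  by move=> w /= sw; exists (size w) => //; exists (in_tuple w).
apply: bigcup_finite => [|n _]; first exact: finite_II.
by apply: finite_image; apply: finite_finset.
Qed.

Lemma finite_transversal (i0 : 'I_d) : finite_set X.
Proof.
have [N XN] := transversal_bounded i0.
exact: sub_finite_set (finite_words N).
Qed.

(** Every word extends to a ray, hence is comparable with a vertex of [X]. *)
Lemma transversal_faithful (i0 : 'I_d) (k : tree_aut d) :
  (forall x, X x -> k x = x) -> (forall x, X x -> section k x = 1%g) -> k = 1%g.
Proof.
move=> kX sX; apply: tree_autP => w.
have [x Xx /orP[/prefixP[u ->]|wx]] := transversal_comparable i0 w.
  by rewrite sectionE kX // sX.
exact: fix_prefix wx (kX x Xx).
Qed.

End Transversals.

(** * Rigid stabilizers *)

Section RigidStabilizers.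
Local Open Scope group_scope.
Variables (d : nat) (G : groupClosed (tree_aut d)).
Hypothesis fgG : finitely_generated G.
Hypothesis branchG : branch G.
Implicit Types (g : tree_aut d) (v w : seq 'I_d).

Lemma infinite_G : infinite_set [set` G].
Proof.
case: branchG => _ infR _ finG; apply: (infR [::]).
by apply: sub_finite_set finG => g [].
Qed.

(** The rigid stabilizer of a level is the direct product of those of its vertices;
    [r] is the projection of [g] to the factor of [v]. *)
Lemma Rist_level_component n g : Rist_level G n g ->
  forall v, size v = n -> g v = v /\ exists2 r, Rist G v r & section r v = section g v.
Proof.
move: g; apply: generated_min => [|g [v' /= sv' Rg] v sv].
  split=> [v sv|f g fP gP v sv].
    by split=> //; exists 1 => //; apply: (Rist_subgroup G v).1.
  have [fv [r Rr er]] := fP v sv; have [gv [s Rs es]] := gP v sv.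
  have gVv : g^-1 v = v by rewrite -{1}gv tree_autK.
  split; first by rewrite tree_autM gVv.
  exists (r / s); first exact: (Rist_subgroup G v).2.
  have /RistE[_ /supported_on_fix sv'] := Rs.
  have sVv : s^-1 v = v by rewrite -{1}sv' tree_autK.
  by rewrite !sectionM !sectionV // sVv gVv er es.
have /RistE[_ sg] := Rg.
have [e|ne] := eqVneq v v'; first by rewrite e; split; [exact: supported_on_fix | exists g].
have gw u : g (v ++ u) = v ++ u.
  apply: sg; rewrite /subtree /= prefixE sv' take_cat sv ltnn subnn take0 cats0.
  exact/negP.
split; first by have := gw [::]; rewrite !cats0.
exists 1; first exact: (Rist_subgroup G v).1.
by apply: tree_autP => u; rewrite section1; have [] := eq_cat_aut erefl (gw u).
Qed.

Lemma finite_by_sections (S : set (tree_aut d)) n :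
    (forall g, S g -> forall v, size v = n -> g v = v) ->
    (forall v, size v = n -> finite_set [set section g v | g in S]) ->
  finite_set S.
Proof.
move=> Sn finS.
have /finite_seqP[s sE] : finite_set
    (\bigcup_(v in [set v | size v = n]) [set section g v | g in S]).
  apply: bigcup_finite => //; apply: sub_finite_set (finite_words d n) => v /= ->.
  exact: leqnn.
pose F g : {ffun n.-tuple 'I_d -> 'I_(size s).+1} :=
  [ffun t : n.-tuple 'I_d => inord (index (section g t) s)].
apply: (finite_set_injective_image (f := F)); last exact: finite_finset.
move=> f g Sf Sg eF; have sec h (t : n.-tuple 'I_d) : S h -> section h t \in s.
  move=> Sh; change ([set` s] (section h t)); rewrite -sE.
  by exists t; [exact: size_tuple | exists h].
have secE (t : n.-tuple 'I_d) : section f t = section g t.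
  have := congr1 (fun F : {ffun _ -> _} => val (F t)) eF.
  rewrite /= !ffunE !inordK ?ltnS ?index_size // => e.
  by rewrite -(nth_index 1 (sec f t Sf)) e nth_index // sec.
apply: tree_autP => w; have [le_nw|lt_wn] := leqP n (size w).
  have st : size (take n w) == n by rewrite size_takel.
  have -> : w = take n w ++ drop n w by rewrite cat_take_drop.
  rewrite !sectionE (Sn f Sf _ (eqP st)) (Sn g Sg _ (eqP st)).
  by rewrite -[take n w]/(val (Tuple st)) secE.
case: w lt_wn => [|i w lt_wn]; first by rewrite !aut_root.
pose u := (i :: w) ++ nseq (n - size (i :: w)) i.
have su : size u = n by rewrite size_cat size_nseq subnKC // ltnW.
have wu : prefix (i :: w) u by apply: prefix_prefix.
by rewrite (fix_prefix wu (Sn f Sf u su)) (fix_prefix wu (Sn g Sg u su)).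
Qed.

(** The rigid stabilizer of the level of [v] contains an infinite finitely
    generated group [<E>], being of finite index.  The components of [E] at the
    vertices of the level cannot all generate finite groups, since they determine
    [<E>].  The rigid stabilizers of the level are conjugate, so it does not
    matter at which vertex this happens. *)
Lemma Rist_infinite_fg v : exists E : seq (tree_aut d),
  [set` E] `<=` Rist G v /\ infinite_set (generated [set` E]).
Proof.
have [trG infR finR] := branchG; set n := size v.
have [X GX] := fgG.
have [||E [ER EX infE]] := @infinite_fg_finite_index _ (Rist_level G n) [set` G] X
    (generated_subgroup _) (finR n).
- by rewrite -GX.
- by rewrite -GX; apply: infinite_G.
have /choice[r rP] (gv : tree_aut d * seq 'I_d) : exists r, Rist_level G n gv.1 ->
    size gv.2 = n -> Rist G gv.2 r /\ section r gv.2 = section gv.1 gv.2.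
  case: (pselect (Rist_level G n gv.1)) => [Rg|]; last by exists 1.
  case: (pselect (size gv.2 = n)) => [sv|]; last by exists 1.
  by have [_ [r]] := Rist_level_component Rg sv; exists r.
pose Ev w := [seq r (g, w) | g <- E].
have EvR w : size w = n -> generated [set` Ev w] `<=` Rist G w.
  move=> sw; apply: generated_min; first exact: Rist_subgroup.
  by move=> _ /mapP[g Eg ->]; have [] := rP (g, w) (ER g Eg) sw.
have comp w g : size w = n -> generated [set` E] g ->
    g w = w /\ exists2 x, generated [set` Ev w] x & section x w = section g w.
  move=> sw; move: g; apply: generated_min => [|g Eg].
    split=> [|f g [fw [x Gx ex]] [gw [y Gy ey]]].
      by split=> //; exists 1 => //; apply: (generated_subgroup _).1.
    have gVw : g^-1 w = w by rewrite -{1}gw tree_autK.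
    split; first by rewrite tree_autM gVw.
    exists (x / y); first exact: (generated_subgroup _).2.
    have /RistE[_ /supported_on_fix yw] := EvR w sw y Gy.
    have yVw : y^-1 w = w by rewrite -{1}yw tree_autK.
    by rewrite !sectionM !sectionV // yVw gVw ex ey.
  split; first by have [] := Rist_level_component (ER g Eg) sw.
  exists (r (g, w)); last by have [] := rP (g, w) (ER g Eg) sw.
  by apply: generated_sub; apply: map_f.
have [w sw infw] : exists2 w, size w = n & infinite_set (generated [set` Ev w]).
  apply: contrapT => nw; apply: infE; apply: (@finite_by_sections _ n).
    by move=> g Eg w sw; have [] := comp w g sw Eg.
  move=> w sw; have finw : finite_set (generated [set` Ev w]).
    by apply: contrapT => infw; apply: nw; exists w.
  apply: sub_finite_set (finite_image (fun x => section x w) finw).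
  by move=> _ [g Eg <-]; have [_ [x Gx ex]] := comp w g sw Eg; exists x.
have [g Gg gw] := trG w v sw.
pose F := [seq g * x * g^-1 | x <- Ev w].
exists F; split.
  move=> _ /mapP[x Ex ->]; have /RistE[Gx sx] := EvR w sw x (generated_sub Ex).
  apply/RistE; split; first by rewrite !gpredM ?gpredV.
  by rewrite -gw; apply: supported_on_conj.
move=> finF; apply: infw.
apply: (finite_set_injective_image (f := fun x => g * x * g^-1)).
  by move=> x y _ _ /mulIg /mulgI.
apply: sub_finite_set finF => _ [x Gx <-]; move: x Gx.
apply: generated_min => [|x Ex]; last exact/generated_sub/map_f.
split; first by rewrite /= mulg1 mulgV; apply: (generated_subgroup _).1.
move=> x y Fx Fy; have := (generated_subgroup [set` F]).2 _ _ Fx Fy.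
by rewrite !invgM invgK !mulgA mulgVK.
Qed.

Lemma Rist_infinite_fg_finite_index Q v : subgroup Q -> finite_index Q [set` G] ->
  exists E : seq (tree_aut d),
    [/\ [set` E] `<=` Q, [set` E] `<=` Rist G v & infinite_set (generated [set` E])].
Proof.
move=> sQ fQ; have [X [XR infX]] := Rist_infinite_fg v.
have XRg : generated [set` X] `<=` Rist G v.
  by apply: generated_min => //; apply: Rist_subgroup.
have [|E [EQ EX infE]] := infinite_fg_finite_index sQ fQ _ infX.
  by move=> x /XRg[].
by exists E; split=> // x /EX/XRg.
Qed.

End RigidStabilizers.

(** * Direct products in finitely generated subgroups *)

Section Chains.
Local Open Scope group_scope.
Variables (d : nat) (G : groupClosed (tree_aut d)).
Hypothesis d_ge2 : (2 <= d)%N.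
Hypothesis fgG : finitely_generated G.
Hypothesis branchG : branch G.

Section NormalSubgroup.
Variables (v : seq 'I_d) (K L : set (tree_aut d)) (l : tree_aut d).
Hypotheses (sK : subgroup K) (sL : subgroup L) (LK : L `<=` K).
Hypothesis K_fix : forall k, K k -> k v = v.
Hypothesis L_normal : forall k h, K k -> L h -> L (k * h * k^-1).
Hypothesis L_faithful : forall h, L h -> section h v = 1 -> h = 1.
Hypothesis finite_index_K : finite_index [set section k v | k in K] [set` G].
Hypotheses (Ll : L l) (l_neq1 : l <> 1).

Let phiM k k' : K k' -> section (k * k') v = section k v * section k' v.
Proof. by move=> Kk; rewrite sectionM K_fix. Qed.

Let phiV k : K k -> section k^-1 v = (section k v)^-1.
Proof. by move=> Kk; rewrite sectionV ?K_fix. Qed.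

(** The elements of [L] whose section at [v], which determines them, lives on [U]. *)
Definition L_on (U : set (seq 'I_d)) : set (tree_aut d) :=
  [set h | L h /\ supported_on U (section h v)].

Lemma L_on_subgroup U : subgroup (L_on U).
Proof.
split; first by split; [exact: sL.1 | rewrite section1].
move=> f g [Lf sf] [Lg sg]; have [Kf Kg] := (LK Lf, LK Lg).
split; first exact: sL.2.
by rewrite phiM ?phiV //; [apply: (supported_on_subgroup _).2 | apply: subgroupV].
Qed.

Lemma L_onS U V : U `<=` V -> L_on U `<=` L_on V.
Proof. by move=> UV g [Lg sg]; split=> //; apply: supported_onS sg. Qed.

Lemma L_on_trivial U V g : U `&` V = set0 -> L_on U g -> L_on V g -> g = 1.
Proof.
move=> UV [Lg sU] [_ sV]; apply: L_faithful => //; apply: supported_on0.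
by rewrite -UV; apply: supported_onI.
Qed.

Lemma L_on_commute U V f g : U `&` V = set0 -> L_on U f -> L_on V g -> f * g = g * f.
Proof.
move=> UV [Lf sf] [Lg sg]; have [Kf Kg] := (LK Lf, LK Lg).
apply: divg1_eq; apply: L_faithful.
  by apply: sL.2; apply: subgroupM.
rewrite phiM ?phiV ?phiM ?(supported_on_commute UV sf sg) ?mulgV //.
  exact: subgroupM.
by apply: subgroupV => //; apply: subgroupM.
Qed.

Let m := section l v.

Lemma moved_vertex : exists w, m w <> w.
Proof.
apply: contrapT => nw; apply: l_neq1; apply: L_faithful => //.
apply: tree_autP => w; apply: contrapT => mw; apply: nw; exists w; exact: mw.
Qed.

(** The map [a |-> a * (m * a^-1 * m^-1)] is not a homomorphism, but restricted to
    the tree below [u] its values are the [a] themselves.  So the group generated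
    by the commutators acts there as [<E>] does, and is infinite with it. *)
Lemma commutator_subgroup u (U := subtree u `|` subtree (m u)) :
    subtree u `&` subtree (m u) = set0 ->
  exists Y : seq (tree_aut d), [set` Y] `<=` L_on U /\ infinite_set (generated [set` Y]).
Proof.
move=> u_mu.
have sQ : subgroup [set section k v | k in K] by apply: section_subgroup.
have [E [EQ ER infE]] := Rist_infinite_fg_finite_index fgG branchG u sQ finite_index_K.
have /choice[lift liftP] a : exists k, a \in E -> K k /\ section k v = a.
  have [/EQ[k Kk ka]|_] := boolP (a \in E); last by exists 1.
  by exists k.
pose c a := lift a * l * (lift a)^-1 * l^-1.
have Lc a : a \in E -> L (c a).
  move=> /liftP[Ka _]; rewrite /c; apply: sL.2 => //.
  exact: L_normal.
have phic a : a \in E -> section (c a) v = a * (m * a^-1 * m^-1).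
  move=> /liftP[Ka ea]; have Kl := LK Ll; have KlV := subgroupV sK Kl.
  have KaV := subgroupV sK Ka.
  by rewrite /c !phiM // !phiV // ea !mulgA.
have supR a : Rist G u a -> supported_on (subtree (m u)) (m * a^-1 * m^-1).
  move=> Ra; apply: supported_on_conj.
  by have /RistE[] := subgroupV (Rist_subgroup G u) Ra.
exists (map c E); split.
  move=> _ /mapP[a Ea ->]; split; first exact: Lc.
  rewrite phic //; have Ra := ER a Ea; apply: (subgroupM (supported_on_subgroup _)).
    by have /RistE[_] := Ra; apply: supported_onS => w; left.
  by move: (supR a Ra); apply: supported_onS => w; right.
move=> finY; apply: infE.
have ERg : generated [set` E] `<=` Rist G u.
  by apply: generated_min => //; apply: Rist_subgroup.
have stab e w : Rist G u e -> subtree u w -> subtree u (e w).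
  by case/RistE => _ /supported_on_stable; apply.
have lifts e : generated [set` E] e -> exists g, [/\ generated [set` map c E] g, K g &
    forall w, subtree u w -> section g v w = e w].
  move=> Ee; suff [] : Rist G u e /\ exists g, [/\ generated [set` map c E] g, K g &
    forall w, subtree u w -> section g v w = e w] by [].
  move: e Ee; apply: generated_min => [|a Ea].
    split; first split; first exact: (Rist_subgroup _ _).1.
      exists 1; split; [exact: (generated_subgroup _).1 | exact: sK.1 |].
      by move=> w _; rewrite section1.
    move=> e f [Re [g [Eg Kg eg]]] [Rf [h [Eh Kh eh]]].
    split; first exact: (Rist_subgroup _ _).2.
    exists (g / h); split; [exact: (generated_subgroup _).2 | exact: sK.2 |].
    move=> w uw; have uw' := stab _ _ (subgroupV (Rist_subgroup G u) Rf) uw.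
    rewrite phiM ?phiV //; last exact: subgroupV.
    rewrite !tree_autM; have -> : (section h v)^-1 w = f^-1 w; last exact: eg.
    by rewrite -{1}(tree_autVK f w) -eh // tree_autK.
  split; first exact: ER.
  exists (c a); split; [exact/generated_sub/map_f | exact/LK/Lc |].
  move=> w uw; rewrite phic // tree_autM (supR a (ER a Ea)) // => muw.
  by rewrite -[False]/(set0 w) -u_mu.
have /choice[g gP] e : exists g, generated [set` E] e -> [/\ generated [set` map c E] g, K g &
    forall w, subtree u w -> section g v w = e w].
  have [/lifts[g ?]|ne] := pselect (generated [set` E] e); first by exists g.
  by exists 1.
apply: (finite_set_injective_image (f := g)).
  move=> e f Ee Ef egf; apply: tree_autP => w.
  have [_ _ ge] := gP e Ee; have [_ _ gf] := gP f Ef.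
  have [uw|uw] := pselect (subtree u w); first by rewrite -ge // -gf // egf.
  have /RistE[_ se] := ERg e Ee; have /RistE[_ sf] := ERg f Ef.
  by rewrite se // sf.
by apply: sub_finite_set finY => _ [e Ee <-]; have [] := gP e Ee.
Qed.

(** The vertices [w a^i b], for two letters [a] and [b], are pairwise incomparable
    and lie below [w], so none is comparable with the image of another under [m],
    which moves [w]. *)
Lemma chain_in_normal_subgroup n : exists Xs : seq (seq (tree_aut d)),
  [/\ size Xs = n, forall Y, Y \in Xs -> [set` Y] `<=` L & infinite_chain [set 1] Xs].
Proof.
have [w mw] := moved_vertex.
pose a : 'I_d := Ordinal (ltnW d_ge2); pose b : 'I_d := Ordinal d_ge2.
pose u i := w ++ (nseq i a ++ [:: b]).
have u_prefix i : prefix w (u i) by apply: prefix_prefix.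
have mu_prefix i : prefix (m w) (m (u i)) by rewrite tree_aut_prefix.
have uu i j : (i < j)%N -> subtree (u i) `&` subtree (u j) = set0.
  move=> lt_ij; apply: (@subtree_disjoint _ (u i) (take (size (u i)) (u j))).
  - rewrite size_takel // !size_cat !size_nseq /= leq_add2l leq_add2r.
    exact: ltnW.
  - move/(congr1 (fun x => nth a x (size w + i))); rewrite nth_take; last first.
      by rewrite !size_cat size_nseq /= ltn_add2l addn1.
    rewrite !nth_cat ltnNge leq_addr /= addKn !size_nseq ltnn subnn lt_ij /=.
    by rewrite nth_nseq lt_ij => /(congr1 val).
  - exact: prefix_refl.
  - exact: prefix_take.
have mm i j : subtree (u i) `&` subtree (m (u j)) = set0.
  apply: (subtree_disjoint _ (nesym mw) (u_prefix i) (mu_prefix j)).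
  by rewrite size_aut.
have mu i j : (i < j)%N -> subtree (m (u i)) `&` subtree (m (u j)) = set0.
  move=> /uu uij; apply/seteqP; split=> // x [mi mj].
  change (set0 (m^-1 x)); rewrite -uij.
  by split; rewrite /subtree /= -(tree_aut_prefix m) tree_autVK.
pose U i := subtree (u i) `|` subtree (m (u i)).
have UU i j : (i < j)%N -> U i `&` U j = set0.
  move=> ij; rewrite setIUl !setIUr uu // mm mu // !set0U !setU0.
  by rewrite setIC mm.
pose V i := \bigcup_(j in `I_i) U j.
have VU i : V i `&` U i = set0.
  apply/seteqP; split=> // x [[j ji Ujx] Uix].
  by change (set0 x); rewrite -(UU j i ji).
have UV i : U i `<=` V i.+1 by move=> x Ux; exists i => //=.
have VV i : V i `<=` V i.+1 by move=> x [j /= ij Ux]; exists j => //=; apply: ltnW.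
have /choice[Y YP] i := commutator_subgroup (mm i i).
have gY i : generated [set` Y i] `<=` L_on (U i).
  by apply: generated_min; [exact: L_on_subgroup | case: (YP i)].
have chainV k i : infinite_chain (L_on (V i)) [seq Y j | j <- iota i k].
  elim: k i => [//|k IH] i /=; split.
  - by case: (YP i).
  - by move=> g /gY Ug Vg; apply: L_on_trivial (VU i) Vg Ug.
  - by move=> g /gY Ug h Vh; apply/esym; apply: L_on_commute (VU i) Vh Ug.
  - exists (L_on (V i.+1)); split; last exact: IH.
    + exact: L_on_subgroup.
    + exact/L_onS/VV.
    + exact: subset_trans (YP i).1 (L_onS (UV i)).
exists [seq Y j | j <- iota 0 n]; split; first by rewrite size_map size_iota.
  by move=> _ /mapP[i _ ->] g /(YP i).1[].
have -> : [set 1] = L_on (V 0) :> set (tree_aut d); last exact: chainV.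
apply/seteqP; split=> [_ ->|g Vg]; first exact: (L_on_subgroup _).1.
apply: (@L_on_trivial _ (V 0) g _ Vg Vg).
by apply/seteqP; split=> // x [[j]].
Qed.

End NormalSubgroup.

Hypothesis selfrepG : self_replicating G.
Hypothesis wsipG : weak_subgroup_induction G.

(** Removing vertices from [s] one at a time, the common kernel of the sections
    changes from the trivial group to all of [K]; [v] is a vertex where it first
    becomes nontrivial. *)
Lemma kernel_flip (K : set (tree_aut d)) (s : seq (seq 'I_d)) :
    (exists2 k, K k & k <> 1) ->
    (forall k, K k -> (forall v, v \in s -> section k v = 1) -> k = 1) ->
  exists v (s' : seq (seq 'I_d)), [/\ {subset v :: s' <= s},
    exists k, [/\ K k, forall u, u \in s' -> section k u = 1 & k <> 1] &
    forall k, K k -> (forall u, u \in v :: s' -> section k u = 1) -> k = 1].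
Proof.
move=> [k0 Kk0 k0_neq1]; elim: s => [|v s IH] triv.
  by case: k0_neq1; apply: triv.
have [triv'|ntriv] := pselect (forall k, K k -> (forall u, u \in s -> section k u = 1) -> k = 1).
  have [v' [s' [sub ? ?]]] := IH triv'; exists v', s'; split=> //.
  by move=> x /sub; rewrite inE orbC => ->.
exists v, s; split=> //; apply: contrapT => nk; apply: ntriv => k Kk ks.
by apply: contrapT => k1; apply: nk; exists k.
Qed.

(** The kernel of the sections at [s'] is normal in [K] and embeds under the section
    at [v]; weak subgroup induction makes the image of [K] there of finite index. *)
Theorem infinite_fg_chain (X : seq (tree_aut d)) n :
    generated [set` X] `<=` [set` G] -> infinite_set (generated [set` X]) ->
  exists Xs : seq (seq (tree_aut d)),
    [/\ size Xs = n, forall Y, Y \in Xs -> [set` Y] `<=` generated [set` X] &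
      infinite_chain [set 1] Xs].
Proof.
move=> XG infX; have [H HX] := subgroup_groupClosed (generated_subgroup [set` X]).
have HG : {subset H <= G} by move=> x Hx; apply: XG; rewrite -HX.
have [|W trW WP] := wsipG HG; first by exists X.
pose i0 : 'I_d := Ordinal (ltnW d_ge2).
have [N WN] := transversal_bounded trW i0.
pose K := Stab H W; have sK : subgroup K by apply: Stab_subgroup.
have [k Kk k_neq1] : exists2 k, K k & k <> 1.
  have [f [g [Hf Hg fg agree]]] := infinite_agree N infX.
  exists (f^-1 * g).
    split=> [|w Ww]; last by rewrite tree_autM -agree ?tree_autK // WN.
    by rewrite -HX in Hf Hg; rewrite gpredM ?gpredV.
  by move/(congr1 (fun h => f * h)); rewrite mulVKg mulg1 => gf; apply: fg.
have /finite_seqP[s Ws] := finite_transversal trW i0.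
have faithful h : K h -> (forall v, v \in s -> section h v = 1) -> h = 1.
  move=> [_ hW] hs; apply: (transversal_faithful trW i0 hW) => x.
  by rewrite Ws; apply: hs.
have [v [s' [sub [l [Kl ls' l_neq1]] flip]]] := kernel_flip (ex_intro2 _ _ k Kk k_neq1) faithful.
have inW u : u \in v :: s' -> W u by move=> /sub; rewrite Ws.
have Wv : W v by apply: inW; apply: mem_head.
have Wu u : u \in s' -> W u by move=> us'; apply: inW; rewrite inE us' orbT.
have K_fix u h : W u -> K h -> h u = u by move=> Wu' [_]; apply.
pose L := [set h | K h /\ forall u, u \in s' -> section h u = 1].
have LK : L `<=` K by move=> h [].
have sL : subgroup L.
  split=> [|f g [Kf fs] [Kg gs]]; first by split=> [|u _]; [exact: sK.1 | exact: section1].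
  split=> [|u us']; first exact: sK.2.
  have [Uu KVg] := (Wu u us', subgroupV sK Kg).
  by rewrite sectionM (K_fix u _ Uu KVg) sectionV ?(K_fix u _ Uu Kg) // fs // gs // mulgV.
have L_normal g h : K g -> L h -> L (g * h * g^-1).
  move=> Kg [Kh hs]; have KVg := subgroupV sK Kg.
  split=> [|u us']; first exact: sK.2 (subgroupM sK Kg Kh) Kg.
  have Uu := Wu u us'.
  rewrite sectionM (K_fix u _ Uu KVg) sectionV ?(K_fix u _ Uu Kg) // sectionM.
  by rewrite (K_fix u _ Uu Kh) hs // mulg1 mulgV.
have L_faithful h : L h -> section h v = 1 -> h = 1.
  move=> [Kh hs] hv; apply: (flip h Kh) => u.
  by rewrite inE => /orP[/eqP ->|/hs].
have Ll : L l by split.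
have fK : finite_index [set section h v | h in K] [set` G].
  have [triv|] := WP v Wv; last by rewrite selfrepG.
  case: l_neq1; apply: L_faithful => //.
  have im : [set section h v | h in K] (section l v) by exists l.
  by rewrite triv in im.
have [Xs [sXs XsL chXs]] := chain_in_normal_subgroup sK sL LK (fun h => K_fix v h Wv)
  L_normal L_faithful fK Ll l_neq1 n.
exists Xs; split=> // Y /XsL YL y /YL[[Hy _] _].
by rewrite -HX.
Qed.

End Chains.

(** * Cohomological dimension of subgroups *)

Section Application.
Variables (d : nat) (G : groupClosed (tree_aut d)).
Hypothesis d_ge2 : (2 <= d)%N.
Hypothesis fgG : finitely_generated G.
Hypothesis selfrepG : self_replicating G.
Hypothesis branchG : branch G.
Hypothesis wsipG : weak_subgroup_induction G.

Lemma infinite_fg_cd (R : nzRingType) (H : groupClosed (tree_aut d))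
    (X : seq (subgroup_type H)) :
    {subset H <= G} -> infinite_set (generated [set` X]) ->
  ~ cd_finite R (subgroup_type H).
Proof.
move=> HG infX [n cdn].
have genE := val_generated X; have genH : generated [set` map val X] `<=` [set` H].
  by rewrite genE => _ [x _ <-]; apply: (valP x).
have [||Xs [sXs XsX chXs]] := @infinite_fg_chain _ _ d_ge2 fgG branchG selfrepG
    wsipG (map val X) n.+1.
- by move=> x /genH /HG.
- rewrite genE => fin; apply: infX; apply: finite_set_injective_image fin.
  by move=> x y _ _; apply: val_inj.
have [Ys YsE] : exists Ys : seq (seq (subgroup_type H)), map (map val) Ys = Xs.
  elim: Xs XsX {sXs chXs} => [|Y Ys IH] YX; first by exists [::].
  have [Zs <-] := IH (fun Z ZYs => YX Z (mem_behead (s := Y :: Ys) ZYs)).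
  have [|Z <-] := @lift_subgroup _ H Y; last by exists (Z :: Zs).
  by move=> y Yy; apply: genH; apply: YX Yy; apply: mem_head.
have {}chXs : infinite_chain [set 1%g] Ys.
  have -> : [set 1%g] = val @^-1` [set 1%g] :> set (subgroup_type H).
    by apply/seteqP; split=> [_ -> //|x /= x1]; apply: val_inj.
  by apply: infinite_chain_val; rewrite YsE.
by apply: infinite_chain_cd chXs _ cdn; rewrite -sXs -YsE size_map.
Qed.

End Application.

Theorem proposition3p22 (d : nat) (G : groupClosed (tree_aut d)) :
  (2 <= d)%N ->
  finitely_generated G ->
  self_replicating G ->
  branch G ->
  weak_subgroup_induction G ->
  jump_cohomology rat G 1 /\ ~ cd_finite rat (subgroup_type G).
Proof.
move=> d_ge2 fgG selfrepG branchG wsipG; have [X GX] := fgG.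
have infinite_cd := infinite_fg_cd d_ge2 fgG selfrepG branchG wsipG (R := rat).
split; last first.
  have [|Y YX] := @lift_subgroup _ G X; first by rewrite GX; apply: generated_sub.
  apply: (infinite_cd G Y) => // finY; apply: (infinite_G branchG).
  by rewrite GX -YX val_generated; apply: finite_image.
move=> H HG cdH; have [f Xf] := generated_countable X.
pose enum i : subgroup_type H := insubd 1%g (f i).
apply: (@locally_finite_cd _ _ enum) => [a|Y]; last first.
  by apply: contrapT => infY; apply: infinite_cd HG infY cdH.
have [|i _ fi] := Xf (val a); first by rewrite -GX; apply/HG/(valP a).
by exists i; apply: val_inj; rewrite val_insubd fi (valP a).
Qed.
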